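(* Let $(\boldsymbol\omega,\mathbf A)\in\Omega\times\mathcal B^{\mathbb C}$ with $\boldsymbol\omega=(P,Q,W)$, $\mathbf A=[A\,|\,B]$. For every eigenvalue of the Sturm–Liouville problem $(\boldsymbol\omega,\mathbf A)$, its analytic, algebraic and geometric multiplicities are equal.
   Context: Let $d\ge2$ and $[a,b]$ compact. $\Omega$ is the set of triples $(P,Q,W)$ of $d\times d$ real symmetric matrix-valued functions in $L^\infty([a,b],\mathbb R^{d\times d})$ with $P(t)\ge\mu_1I_d$, $W(t)\ge\mu_2I_d$ a.e. for some $\mu_1,\mu_2>0$. $\mathcal B^{\mathbb C}$ is the set of classes $[A\,|\,B]$ of complex $2d\times4d$ matrices $(A\,|\,B)$ with $\operatorname{rank}(A\,|\,B)=2d$ and $AB^*=BA^*$, modulo $(A\,|\,B)\sim(TA\,|\,TB)$, $T\in GL(2d,\mathbb C)$. The boundary condition is $(A\,|\,B)Y(a,b)=0$ with $Y(a,b)=(-y(a)^T,y(b)^T,(Py')(a)^T,(Py')(b)^T)^T$. Let $L^2_W([a,b],\mathbb C^d)$ be the space with inner product $\langle y,z\rangle_W=\int_a^b z^*Wy\,dt$. The operator is $T y=W^{-1}(-(Py')'+Qy)$ on $D_{\mathbf A}=\{y\in L^2_W: y,Py'\text{ absolutely continuous}, Ty\in L^2_W, y\text{ satisfies the boundary condition}\}$; it is self-adjoint and $\lambda$ is an eigenvalue iff $\lambda$ is a zero of $\Gamma(\lambda)=\det(A\Phi_\lambda+B\Psi_\lambda)$, where $\phi_{1,\lambda},\dots,\phi_{2d,\lambda}$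 are the solutions of $-(Py')'+Qy=\lambda Wy$ whose initial data $(\phi_{j,\lambda}(a),(P\phi'_{j,\lambda})(a))$ form the columns of $I_{2d}$, $\Phi_\lambda$ has $j$-th column $(-\phi_{j,\lambda}(a)^T,\phi_{j,\lambda}(b)^T)^T$ and $\Psi_\lambda$ has $j$-th column $((P\phi'_{j,\lambda})(a)^T,(P\phi'_{j,\lambda})(b)^T)^T$. The analytic multiplicity of an eigenvalue $\lambda$ is its order as a zero of $\Gamma$; the geometric multiplicity is the number of linearly independent eigenfunctions; the algebraic multiplicity is $\dim\{y\in L^2_W: (T-\lambda)^ky=0\text{ for some integer }k\ge1\}$. *)

(* Defs.v *)
(* mathcomp + mathcomp-analysis, complex numbers R[i] from
   mathcomp-real-closed. *)
From HB Require Import structures.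
From mathcomp Require Import all_boot all_order all_algebra.
From mathcomp Require Import all_classical all_reals all_analysis.
From mathcomp.real_closed Require Import complex.
Import Order.TTheory GRing.Theory Num.Theory.
Import numFieldNormedType.Exports.

Set Implicit Arguments.
Unset Strict Implicit.
Unset Printing Implicit Defensive.

Local Open Scope ring_scope.

Section SturmLiouville.
Context {R : realType} {d : nat}.
Local Notation C := (R[i]).
Local Notation cvec := ('cV[C]_d).

(* "for almost every t in [a,b]" (Lebesgue measure) *)
Definition aeI (a b : R) (p : R -> Prop) : Prop :=
  {ae (@lebesgue_measure R), forall t, t \in `[a, b] -> p t}.

(* absolute continuity of a real function on [a,b] (epsilon-delta definition
   with finite families of non-overlapping subintervals) *)
Definition abs_cont (a b : R) (f : R -> R) : Prop :=
  forall e : R, 0 < e -> exists2 delta : R, 0 < delta &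
    forall (n : nat) (s : 'I_n -> R * R),
      (forall i, a <= (s i).1 /\ (s i).1 <= (s i).2 /\ (s i).2 <= b) ->
      (forall i j, i != j -> (s i).2 <= (s j).1 \/ (s j).2 <= (s i).1) ->
      \sum_(i < n) ((s i).2 - (s i).1) < delta ->
      \sum_(i < n) `|f (s i).2 - f (s i).1| < e.

(* a C^d-valued function is absolutely continuous iff the real and imaginary
   parts of all its components are *)
Definition ac_cv (a b : R) (f : R -> cvec) : Prop :=
  forall i : 'I_d, abs_cont a b (fun t => complex.Re (f t i 0)) /\
                   abs_cont a b (fun t => complex.Im (f t i 0)).

(* f : R -> C^d is differentiable at t with derivative v *)
Definition has_deriv_cv (f : R -> cvec) (t : R) (v : cvec) : Prop :=
  forall i : 'I_d,
    is_derive (t : R) (1 : R) (fun s => complex.Re (f s i 0)) (complex.Re (v i 0)) /\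
    is_derive (t : R) (1 : R) (fun s => complex.Im (f s i 0)) (complex.Im (v i 0)).

(* real matrix seen as a complex matrix *)
Definition cmx (M : 'M[R]_d) : 'M[C]_d := map_mx (fun x : R => Complex x 0) M.

(* conjugate transpose *)
Definition adjmx m n (M : 'M[C]_(m, n)) : 'M[C]_(n, m) :=
  map_mx (fun z : C => z^*) M^T.

(* ---------- the coefficient set Omega ---------- *)
Definition Linf_mx (a b : R) (M : R -> 'M[R]_d) : Prop :=
  (forall i j, measurable_fun `[a, b] (fun t => M t i j)) /\
  exists K : R, aeI a b (fun t => forall i j, `|M t i j| <= K).

Definition sym_ae (a b : R) (M : R -> 'M[R]_d) : Prop :=
  aeI a b (fun t => (M t)^T = M t).

(* M(t) >= mu I_d a.e. (Loewner order) *)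
Definition ge_scalar_ae (a b : R) (M : R -> 'M[R]_d) (mu : R) : Prop :=
  aeI a b (fun t => forall v : 'cV[R]_d,
    mu * (v^T *m v) 0 0 <= (v^T *m M t *m v) 0 0).

Definition in_Omega (a b : R) (P Q W : R -> 'M[R]_d) : Prop :=
  [/\ Linf_mx a b P /\ Linf_mx a b Q /\ Linf_mx a b W,
      sym_ae a b P /\ sym_ae a b Q /\ sym_ae a b W,
      (exists2 mu1 : R, 0 < mu1 & ge_scalar_ae a b P mu1) &
      (exists2 mu2 : R, 0 < mu2 & ge_scalar_ae a b W mu2)].

(* ---------- self-adjoint complex boundary conditions B^C ---------- *)
(* (A | B) is the 2d x 4d matrix row_mx A B *)
Definition bc_ok (A B : 'M[C]_(d + d)) : Prop :=
  \rank (row_mx A B) = (d + d)%N /\ A *m adjmx B = B *m adjmx A.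

(* Y(a,b) = (-y(a), y(b), (Py')(a), (Py')(b)) *)
Definition Yab (a b : R) (y p : R -> cvec) : 'cV[C]_((d + d) + (d + d)) :=
  col_mx (col_mx (- y a) (y b)) (col_mx (p a) (p b)).

(* ---------- the weighted space L^2_W ---------- *)
Definition meas_cv (a b : R) (y : R -> cvec) : Prop :=
  forall i : 'I_d, measurable_fun `[a, b] (fun t => complex.Re (y t i 0)) /\
                   measurable_fun `[a, b] (fun t => complex.Im (y t i 0)).

(* y(t)^* W(t) y(t)  (a real number) *)
Definition wform (W : R -> 'M[R]_d) (y : R -> cvec) (t : R) : R :=
  complex.Re ((adjmx (y t) *m cmx (W t) *m y t) 0 0).

Definition L2W (a b : R) (W : R -> 'M[R]_d) (y : R -> cvec) : Prop :=
  meas_cv a b y /\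
  (\int[@lebesgue_measure R]_(t in `[a, b]) (wform W y t)%:E < +oo)%E.

(* ---------- the operator T ---------- *)
(* SLT y z : y belongs to D_A and T y = z (as elements of L^2_W, i.e. up to
   a.e. equality).  y0 is the absolutely continuous representative of y, and
   p0 the absolutely continuous function equal a.e. to P y0'. *)
Definition SLT (a b : R) (P Q W : R -> 'M[R]_d) (A B : 'M[C]_(d + d))
    (y z : R -> cvec) : Prop :=
  exists y0 p0 : R -> cvec,
  [/\ aeI a b (fun t => y0 t = y t),
      ac_cv a b y0 /\ ac_cv a b p0,
      aeI a b (fun t => exists2 dy, has_deriv_cv y0 t dy &
                                     p0 t = cmx (P t) *m dy) /\
      aeI a b (fun t => exists2 dp, has_deriv_cv p0 t dp &
                z t = invmx (cmx (W t)) *m (- dp + cmx (Q t) *m y0 t)),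
      L2W a b W y /\ L2W a b W z &
      row_mx A B *m Yab a b y0 p0 = 0].

Definition ae_zero (a b : R) (y : R -> cvec) : Prop := aeI a b (fun t => y t = 0).

(* y is an eigenfunction for lam *)
Definition eigenfun a b P Q W A B (lam : C) (y : R -> cvec) : Prop :=
  SLT a b P Q W A B y (fun t => lam *: y t) /\ ~ ae_zero a b y.

Definition is_eigenvalue a b P Q W A B (lam : C) : Prop :=
  exists y, eigenfun a b P Q W A B lam y.

(* sl_eigenspace  {y in D_A | T y = lam y} *)
Definition sl_eigenspace a b P Q W A B (lam : C) (y : R -> cvec) : Prop :=
  SLT a b P Q W A B y (fun t => lam *: y t).

(* gker k y : y in L^2_W, y in D((T - lam)^k) and (T - lam)^k y = 0 *)
Fixpoint gker a b P Q W A B (lam : C) (k : nat) (y : R -> cvec) : Prop :=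
  match k with
  | 0 => L2W a b W y /\ ae_zero a b y
  | k'.+1 => exists z, SLT a b P Q W A B y z /\
                       gker a b P Q W A B lam k' (fun t => z t - lam *: y t)
  end.

(* root subspace {y in L^2_W : (T - lam)^k y = 0 for some k >= 1} *)
Definition sl_gen_eigenspace a b P Q W A B (lam : C) (y : R -> cvec) : Prop :=
  exists2 k, (1 <= k)%N & gker a b P Q W A B lam k y.

(* linear independence in L^2_W (i.e. modulo a.e. equality on [a,b]) *)
Definition ae_indep (a b : R) n (f : 'I_n -> R -> cvec) : Prop :=
  forall c : 'I_n -> C, ae_zero a b (fun t => \sum_(i < n) c i *: f i t) ->
    forall i, c i = 0.

(* the subspace S (of L^2_W) has dimension n *)
Definition dim_ae (a b : R) (S : (R -> cvec) -> Prop) (n : nat) : Prop :=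
  (exists f : 'I_n -> R -> cvec, (forall i, S (f i)) /\ ae_indep a b f) /\
  (forall m (f : 'I_m -> R -> cvec), (forall i, S (f i)) -> ae_indep a b f ->
     (m <= n)%N).

(* ---------- the characteristic function SL_Gamma ---------- *)
(* (y, p) solves -(P y')' + Q y = lam W y on [a,b], with p = P y' *)
Definition sl_sol a b (P Q W : R -> 'M[R]_d) (lam : C) (y p : R -> cvec) : Prop :=
  [/\ ac_cv a b y, ac_cv a b p,
      aeI a b (fun t => exists2 dy, has_deriv_cv y t dy & p t = cmx (P t) *m dy) &
      aeI a b (fun t => exists2 dp, has_deriv_cv p t dp &
                 (- dp + cmx (Q t) *m y t = lam *: (cmx (W t) *m y t)))].

(* phi lam j = phi_{j,lam}, pphi lam j = P phi_{j,lam}'; initial data at a are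
   the columns of I_{2d} *)
Definition fund_sys a b (P Q W : R -> 'M[R]_d)
    (phi pphi : C -> 'I_(d + d) -> R -> cvec) : Prop :=
  forall (lam : C) (j : 'I_(d + d)),
    sl_sol a b P Q W lam (phi lam j) (pphi lam j) /\
    col_mx (phi lam j a) (pphi lam j a) = col j (1%:M : 'M[C]_(d + d)).

Definition PhiM a b (phi : C -> 'I_(d + d) -> R -> cvec) (lam : C)
    : 'M[C]_(d + d) :=
  \matrix_(i, j) (col_mx (- phi lam j a) (phi lam j b)) i 0.

Definition PsiM a b (pphi : C -> 'I_(d + d) -> R -> cvec) (lam : C)
    : 'M[C]_(d + d) :=
  \matrix_(i, j) (col_mx (pphi lam j a) (pphi lam j b)) i 0.

Definition SL_Gamma a b (A B : 'M[C]_(d + d)) (phi pphi : C -> 'I_(d + d) -> R -> cvec)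
    (lam : C) : C :=
  \det (A *m PhiM a b phi lam + B *m PsiM a b pphi lam).

(* lam0 is a zero of order n of G (complex derivatives) *)
Definition zero_order (G : C -> C) (lam0 : C) (n : nat) : Prop :=
  (forall k, (k < n)%N -> @derive1n C C^o k G lam0 = 0) /\
  @derive1n C C^o n G lam0 != 0.

End SturmLiouville.

(* Main.v *)
(** The equation is treated as a first-order system for [(y, P y')] whose solutions
    are Lipschitz.  An absolutely continuous function with nonpositive derivative
    almost everywhere is nonincreasing; with it, Gronwall's inequality and all the
    identities below can be used without integrating.

    Let [M l = A Phi_l + B Psi_l], so that the eigenfunctions for [l] correspond to the
    kernel of [M l].  For two solutions, [F = u^* (P y') - (P u')^* y] takes equal values
    at [a] and [b] by self-adjointness of the boundary condition.  If [(T - l) u = 0]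
    and [(T - l) y = u] with [l] real, then [F' = - u^* W u <= 0], so [F] is constant and
    [u = 0].  Hence there is no Jordan chain of length two, and the algebraic and
    geometric multiplicities agree.

    Solutions depend smoothly on [l]: the derivative with respect to [l] solves an
    augmented linear system of the same kind.  A pair [v, w] with [M l v = 0] and
    [M l w + M' l v = 0] yields the chain [u = Phi_l v], [y = Phi_l w + Phi'_l v], so
    [v = 0]; therefore [M' l] maps the kernel of [M l] injectively into its cokernel,
    and [det M] vanishes at [l] exactly to the order [dim (ker (M l))]. *)

Require Import Defs.
From HB Require Import structures.
From mathcomp Require Import all_boot all_order all_algebra.
From mathcomp Require Import all_classical all_reals all_analysis.
From mathcomp.real_closed Require Import complex.
From mathcomp Require Import perm measurable_realfun ring lra.
Import Order.TTheory GRing.Theory Num.Theory.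
Import numFieldNormedType.Exports.

Set Implicit Arguments.
Unset Strict Implicit.
Unset Printing Implicit Defensive.

Local Open Scope ring_scope.

(** Bounded coefficients are what makes integration avoidable: [P y'] is absolutely continuous,
    hence bounded, and the inverse of [P] is bounded because [P >= mu1], so [y'] is bounded almost
    everywhere and [y] is Lipschitz. Lipschitz functions are closed under products, as the
    sesquilinear forms require. The eigenvalue is real by the same form [F] with [y = u]: then
    [Im l * Im F] is nonincreasing. Generalized eigenfunctions of any height reduce to chains of
    length two by induction on the height. The determinant is expanded by columns. After
    multiplication by a constant invertible matrix, as many columns vanish at [l] as the kernel has
    dimensions; each contributes one order, and the remaining coefficient is a determinant that the
    absence of chains makes nonzero. Since up to [2d] columns may vanish, iterated derivatives in
    the parameter must exist. The first one is a limit of difference quotients, controlled by a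
    Gronwall constant that does not depend on the solution. *)

(* Over [K := R[i]] this is complex differentiability: [is_derive] cannot be
   stated there directly, since [R[i]] has no canonical normed structure. *)
Definition lin_approx (K : numFieldType) (f : K -> K) (t v : K) :=
  forall e : K, 0 < e -> exists2 del : K, 0 < del &
    forall s, `|s - t| < del -> `|f s - f t - v * (s - t)| <= e * `|s - t|.

Lemma is_derive_lin_approx (K : numFieldType) (f : K -> K^o) (t v : K) :
  is_derive t 1 f v -> lin_approx f t v.
Proof.
move=> [df <-] e e0.
move: df; rewrite /derivable /derive => /cvgrPdist_lt /(_ e e0).
set l := lim _ => /nbhs_ballP [del del0 H].
exists del => // s st; have [->|nst] := eqVneq s t.
  by rewrite !subrr mulr0 subr0 !normr0 mulr0.
have := H (s - t); rewrite -[ball _ _ _]/(ball (0:K) del (s - t)) /ball /= sub0r normrN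
  => /(_ st).
rewrite subr_eq0 => /(_ nst) {}H.
have nz : s - t != 0 by rewrite subr_eq0.
have E : f s - f t - l * (s - t) =
  (s - t) * - (l - (s - t)^-1 *: (f (((s - t) *: (1:K)) + t) - f t)).
  have -> : (s - t) *: (1:K) + t = s by rewrite /GRing.scale /= mulr1 subrK.
  by rewrite /GRing.scale /= opprB [RHS]mulrBr mulrA divff // mul1r [l * _]mulrC.
rewrite E normrM normrN mulrC ler_pM2r ?normr_gt0 //; exact: ltW.
Qed.

Lemma lin_approx_is_derive (K : numFieldType) (f : K -> K^o) (t v : K) :
  lin_approx f t v -> is_derive t 1 f v.
Proof.
move=> H; suff cv : ((fun h : K => h^-1 *: (f (h *: (1:K) + t) - f t)) @ 0^' --> (v :
  K^o))%classic.
  by split; [apply/cvg_ex; exists v | apply/cvg_lim].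
apply/cvgrPdist_lt => e e0.
(* Halving turns the non-strict bound of [lin_approx] into the strict one that the limit
   requires. *)
have e20 : 0 < e / 2 by rewrite divr_gt0.
have [del del0 {}H] := H _ e20.
apply/nbhs_ballP; exists del => // h.
rewrite -[ball _ _ _]/(ball (0:K) del h) /ball /= sub0r normrN => hd h0.
have := H (h + t); rewrite addrK => /(_ hd) {}H.
rewrite -[v - _]/(v - h^-1 * (f (h * 1 + t) - f t)) mulr1.
have -> : v - h^-1 * (f (h + t) - f t) = h^-1 * - (f (h + t) - f t - v * h).
  by rewrite opprB [RHS]mulrBr [v * h]mulrC mulrA mulVf // mul1r.
rewrite normrM normrN normfV mulrC ltr_pdivrMr ?normr_gt0 //.
apply: le_lt_trans H _; rewrite ltr_pM2r ?normr_gt0 //.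
by rewrite ltr_pdivrMr // ltr_pMr // (_ : 1 < 2) // ltr1n.
Qed.

(** * Properties holding almost everywhere on a compact interval *)

Section AlmostEverywhere.
Context {R : realType}.
Implicit Types (a b : R) (p q : R -> Prop).

Local Instance ae_lebesgue_filter :
  Filter (nbhs (almost_everywhere (@lebesgue_measure R))).
Proof. exact: ae_filter_ringOfSetsType. Qed.

Lemma aeI_all a b p : (forall t, t \in `[a, b] -> p t) -> aeI a b p.
Proof. by move=> H; apply: nearW. Qed.

Lemma aeI_mp a b p q : aeI a b p -> aeI a b (fun t => p t -> q t) -> aeI a b q.
Proof.
rewrite /aeI => Hp Hq.
by apply: filterS2 Hp Hq => t Hp Hq tI; apply: Hq => //; apply: Hp.
Qed.

Lemma aeI_imp a b p q : (forall t, t \in `[a, b] -> p t -> q t) ->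
  aeI a b p -> aeI a b q.
Proof. by move=> H Hp; apply: aeI_mp Hp _; apply: aeI_all. Qed.

Lemma aeI_and a b p q : aeI a b p -> aeI a b q -> aeI a b (fun t => p t /\ q t).
Proof.
by move=> Hp Hq; apply: aeI_mp Hq _; apply: aeI_imp Hp => t _ pt qt; split.
Qed.

Lemma aeI_nat a b (p : nat -> R -> Prop) :
  (forall n, aeI a b (p n)) -> aeI a b (fun t => forall n, p n t).
Proof.
move=> H; apply: (negligibleS _ (negligible_bigcup H)) => t /=.
move=> /existsNP [tI] /existsNP [n np]; exists n => //=.
by move=> Hn; apply: np; apply: Hn.
Qed.

Lemma aeI_fin a b (I : finType) (p : I -> R -> Prop) :
  (forall i, aeI a b (p i)) -> aeI a b (fun t => forall i, p i t).
Proof.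
move=> H.
have : aeI a b (fun t => forall n, if unpickle n is Some i then p i t else True).
  apply: aeI_nat => n; case: (unpickle n) => [i|]; first exact: H.
  exact: aeI_all.
by apply: aeI_imp => t _ Ht i; have := Ht (pickle i); rewrite pickleK.
Qed.

Lemma aeI_neq a b c : aeI a b (fun t => t <> c).
Proof.
rewrite /aeI /prop_near1 /nbhs /= /almost_everywhere.
exists [set c]%classic; split => //.
  exact: lebesgue_measure_set1.
move=> t /= H; apply: contrapT => tc; apply: H => _ .
by [].
Qed.

Lemma aeI_oo a b : aeI a b (fun t => t \in `]a, b[).
Proof.
have := aeI_and (aeI_neq a b a) (aeI_neq a b b).
apply: aeI_imp => t; rewrite !in_itv /= => /andP[t1 t2] [/eqP na /eqP nb].
by rewrite !lt_neqAle t1 t2 nb eq_sym na.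
Qed.

Lemma aeI_sub a b c e p : a <= c -> e <= b -> aeI a b p -> aeI c e p.
Proof.
rewrite /aeI => ac eb; apply: filterS => t H; rewrite in_itv /= => /andP[t1 t2].
by apply: H; rewrite in_itv /= (le_trans ac t1) (le_trans t2 eb).
Qed.

(** A nondegenerate interval has positive measure, so the exceptional set cannot cover it. *)
Lemma aeI_ex a b p : a < b -> aeI a b p -> exists2 t, t \in `[a, b] & p t.
Proof.
move=> ab; rewrite /aeI /prop_near1 /nbhs /= /almost_everywhere => -[N [mN N0 HN]].
apply: contrapT => H.
have sub : (`[a, b]%classic `<=` N)%classic.
  move=> t tI; apply: HN => /= Ht; apply: H; exists t => //; exact: Ht.
have : (@lebesgue_measure R `[a, b]%classic <= @lebesgue_measure R N)%E.
  by apply: le_measure; rewrite ?inE //; exact: measurable_itv.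
rewrite lebesgue_measure_itv /= lte_fin ab (N0 : lebesgue_measure N = 0%E).
by rewrite -EFinD lee_fin subr_le0 leNgt ab.
Qed.

End AlmostEverywhere.

(** * Increments of absolutely continuous functions *)

Section AbsoluteContinuity.
Context {R : realType}.
Implicit Types (a b : R) (f : R -> R).

(** Real induction: the supremum [c] of the points [x] with [Pr a x] cannot stop short of [b], since
    the local hypothesis at [c] covers an interval across [c]. In that hypothesis [t] is the tag of
    [[u, v]]; gluing keeps the tagged partition implicit. *)
Lemma cousin a b (Pr : R -> R -> Prop) : a <= b ->
  (forall u v w, u <= v -> v <= w -> Pr u v -> Pr v w -> Pr u w) ->
  (forall t, a <= t -> t <= b -> exists2 del, 0 < del &
     forall u v, a <= u -> u <= t -> t <= v -> v <= b -> v - u < del -> Pr u v) ->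
  Pr a b.
Proof.
move=> ab glue loc.
pose S : set R := fun x => (a <= x) /\ (x <= b) /\ Pr a x.
have Sa : S a.
  split => //; split => //; have [del d0 H] := loc a (lexx _) ab.
  by apply: H => //; rewrite subrr.
have ubS : ubound S b by move=> x [_ []].
have hS : has_sup S by split; [exists a | exists b].
pose c := sup S.
have ac : a <= c by apply: ub_le_sup => //; exists b.
have cb : c <= b by apply: ge_sup => //; exists a.
have [del d0 H] := loc c ac cb.
have d2 : 0 < del / 2 by lra.
have [x [ax [xb Prx]] cx] := sup_adherent d2 hS.
have xc : x <= c by apply: ub_le_sup; [exists b|].
rewrite -/c in cx.
(* As [x] exceeds [c - del / 2], the interval from [x] to [c + del / 4], or to [b] if [b] comes no
   later, is shorter than [del]. *)
have [bc|cb'] := leP b (c + del / 4).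
  by apply: (glue _ x) => //; apply: H => //; lra.
have : S (c + del / 4).
  split; [lra|split; first exact: ltW].
  by apply: (glue _ x) => //; [lra|apply: H => //; lra].
by move/(ub_le_sup (ex_intro _ b ubS)); rewrite -/c => ?; exfalso; lra.
Qed.

(** Ordered lists concatenate, which the gluing hypothesis of [cousin] calls for; families indexed
    by ['I_n] would have to be reindexed. *)
Lemma seq_abs_cont a b f e : abs_cont a b f -> 0 < e -> exists2 del, 0 < del &
  forall s : seq (R * R),
    all (fun x => [&& a <= x.1, x.1 <= x.2 & x.2 <= b]) s ->
    pairwise (fun x y => x.2 <= y.1) s ->
    \sum_(x <- s) (x.2 - x.1) < del -> \sum_(x <- s) `|f x.2 - f x.1| < e.
Proof.
move=> fac e0; have [del d0 H] := fac e e0; exists del => // s sI sp.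
rewrite !(big_nth (0, 0)) !big_mkord => sd.
apply: (H _ (fun i : 'I_(size s) => nth (0, 0) s i)) sd => [i|i j ij].
  by have /and3P[] := all_nthP (0,0) sI i (ltn_ord i).
have Hp := pairwiseP (0, 0) sp.
have [lij|lji|eij] := ltngtP i j.
- by left; apply: Hp; rewrite ?inE.
- by right; apply: Hp; rewrite ?inE.
- by rewrite (val_inj eij) eqxx in ij.
Qed.

(* Cousin's lemma produces a tagged partition.  The intervals tagged by points
   of the exceptional null set lie in an open set of small measure, so absolute
   continuity bounds their contribution. *)
Lemma abs_cont_le_derive a b L f : a <= b -> 0 <= L -> abs_cont a b f ->
  aeI a b (fun t => exists2 v : R, is_derive t 1 f v & v <= L) ->
  f b - f a <= L * (b - a).
Proof.
move=> ab L0 fac [N [mN N0 HN]].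
(* The excess slope [e] comes from differentiability at good tags, the additive [e] from absolute
   continuity on the bad intervals. *)
suff H e : 0 < e -> f b - f a <= (L + e) * (b - a) + e.
  apply/ler_addgt0Pr => e e0.
  have k0 : 0 < 1 + (b - a) by lra.
  have := H (e / (1 + (b - a))) (divr_gt0 e0 k0).
  set e' := e / _; have -> : e = e' * (1 + (b - a)).
    by rewrite /e' divfK // gt_eqF.
  by move=> H'; apply: le_trans H' _; nra.
move=> e0; have [del d0 Hdel] := seq_abs_cont fac e0.
have Noo : (@lebesgue_measure R N < +oo)%E.
  by rewrite (N0 : lebesgue_measure N = 0%E) ltry.
have [U [oU NU muU]] := @lebesgue_regularity_outer R N del mN Noo d0.
have mU : measurable U by exact: open_measurable.
have {}muU : (@lebesgue_measure R U < del%:E)%E.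
  have -> : U = (U `\` N `|` N)%classic by rewrite setUC setDUK.
  have : (@lebesgue_measure R (U `\` N `|` N)%classic <=
      @lebesgue_measure R (U `\` N)%classic + @lebesgue_measure R N)%E.
    by apply: measureU2 => //; exact: measurableD.
  rewrite (N0 : lebesgue_measure N = 0%E) adde0 => H; exact: le_lt_trans H muU.
(* Half-open intervals make [mo] additive over adjacent intervals. *)
pose mo u v := (@lebesgue_measure R (U `&` `]u, v]))%classic.
have moD u v w : u <= v -> v <= w -> mo u w = (mo u v + mo v w)%E.
  move=> uv vw; rewrite /mo.
  have -> : `]u, w]%classic = (`]u, v] `|` `]v, w])%classic.
    by rewrite -itv_bndbnd_setU // bnd_simp.
  rewrite setIUr measureU //; try by apply: measurableI => //; exact: measurable_itv.
  apply/seteqP; split => x //= [[_ +] [_ +]].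
  by rewrite /= !in_itv /= => /andP[_ xv] /andP[vx _]; rewrite leNgt vx in xv.
(* The list collects the intervals tagged in [U]: the measure of [U] pays for their lengths, and
   their increments are kept for absolute continuity. All other increments are bounded through the
   slope [L + e]. *)
pose Pr u v := exists s : seq (R * R), [/\
  all (fun x => [&& u <= x.1, x.1 <= x.2 & x.2 <= v]) s,
  pairwise (fun x y => x.2 <= y.1) s,
  ((\sum_(x <- s) (x.2 - x.1))%:E <= mo u v)%E &
  f v - f u <= (L + e) * (v - u) + \sum_(x <- s) `|f x.2 - f x.1|].
have [s [sI sp smo sf]] : Pr a b.
  apply: cousin ab _ _.
    move=> u v w uv vw [s1 [s1I s1p s1m s1f]] [s2 [s2I s2p s2m s2f]].
    exists (s1 ++ s2); split.
    - rewrite all_cat; apply/andP; split.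
        apply: sub_all s1I => x /and3P[-> -> /= xv]; exact: le_trans xv vw.
      by apply: sub_all s2I => x /and3P[vx -> ->]; rewrite (le_trans uv vx).
    - rewrite pairwise_cat s1p s2p !andbT; apply/allrelP => x y xs ys.
      have /and3P[_ _ xv] := allP s1I x xs; have /and3P[vy _ _] := allP s2I y ys.
      exact: le_trans xv vy.
    - by rewrite big_cat /= EFinD (moD u v w) //; exact: leeD.
    - rewrite big_cat /=; move: s1f s2f; set S1 := \sum_(_ <- _) _; set S2 := \sum_(_ <- _) _.
      by move=> s1f s2f; lra.
  (* Tags are separated by [U] rather than [N]: around a tag in the open set [U] a short interval
     lies inside [U], and off [U] the derivative exists. *)
  move=> t at' tb; have [tU|tU] := pselect (U t).
    have /nbhs_ballP[del' d'0 bU] : nbhs t U by exact: open_nbhs_nbhs.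
    exists del' => // u v au ut tv vb uvd.
    exists [:: (u, v)]; rewrite /= !big_seq1 /= !lexx (le_trans ut tv); split => //.
      rewrite /mo setIidr; first by
        rewrite lebesgue_measure_itv /= lte_fin; case: ltP => uv;
          rewrite -?EFinD lee_fin; lra.
      move=> x; rewrite /= in_itv /= => /andP[ux xv]; apply: bU.
      by rewrite /ball /= ltr_norml; lra.
    apply: ler_wpDl; last exact: ler_norm.
    by apply: mulr_ge0; lra.
  have tI : t \in `[a, b] by rewrite in_itv /= at' tb.
  have [] : exists2 v : R, is_derive t 1 f v & v <= L.
    by apply: contrapT => Ht; apply: tU; apply: NU; apply: HN => /= /(_ tI).
  move=> l /is_derive_lin_approx /(_ e e0) [del' d'0 Hl] lL.
  exists del' => // u v au ut tv vb uvd.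
  have mo0 : (0 <= mo u v)%E by rewrite /mo; exact: (measure_ge0 (@lebesgue_measure R)).
  exists [::]; rewrite /= !big_nil addr0; split => //.
  have := Hl u; have := Hl v; rewrite !ler_norml ltr_norml (ger0_norm (_ : 0 <= v - t));
    last lra.
  rewrite ltr_norml (ler0_norm (_ : u - t <= 0)); last lra.
  move=> /(_ _)/andP [|_ hv]; first lra.
  move=> /(_ _)/andP [|hu _]; first lra.
  nra.
have := Hdel s sI sp.
have : \sum_(x <- s) (x.2 - x.1) < del.
  rewrite -lte_fin; apply: le_lt_trans smo _; apply: le_lt_trans muU.
  by apply: le_measure; rewrite ?inE //; apply: measurableI => //; exact: measurable_itv.
by move=> h /(_ h) {}h; apply: le_trans sf _; rewrite lerD2l ltW.
Qed.
End AbsoluteContinuity.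

(** * Lipschitz functions on a compact interval *)

Section RealLipschitz.
Context {R : realType}.
Implicit Types (a b : R) (f g : R -> R).

Lemma abs_cont_sub a b u v f : a <= u -> v <= b -> abs_cont a b f -> abs_cont u v f.
Proof.
move=> au vb H e e0; have [del d0 {}H] := H e e0; exists del => // n s s1.
apply: H => i; have [h1 [h2 h3]] := s1 i.
by split; [exact: le_trans au h1|split => //; exact: le_trans h3 vb].
Qed.

Lemma abs_contN a b f : abs_cont a b f -> abs_cont a b (fun t => - f t).
Proof.
move=> H e e0; have [del d0 {}H] := H e e0; exists del => // n s s1 s2 s3.
have := H n s s1 s2 s3; congr (_ < _); apply: eq_bigr => i _.
by rewrite -opprD normrN.
Qed.

(** Local boundedness, from absolute continuity on a single interval with tolerance 1, is glued by
    [cousin]. *)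
Lemma abs_cont_bounded a b f : a <= b -> abs_cont a b f ->
  exists2 M : R, 0 <= M & forall t, t \in `[a, b] -> `|f t| <= M.
Proof.
move=> ab H.
pose Pr u v := exists2 M : R, 0 <= M & forall t, t \in `[u, v] -> `|f t| <= M.
suff : Pr a b by [].
apply: cousin => //.
  move=> u v w uv vw [M1 M10 H1] [M2 M20 H2]; exists (M1 + M2); first lra.
  move=> t; rewrite in_itv /= => /andP[ut tw].
  have [tv|vt] := leP t v.
    by have := H1 t; rewrite in_itv /= ut tv => /(_ isT); lra.
  by have := H2 t; rewrite in_itv /= (ltW vt) tw => /(_ isT); lra.
move=> t at' tb; have [del d0 {}H] := seq_abs_cont H (@ltr01 R).
exists del => // u v au ut tv vb uvd; exists (`|f t| + 1);
  first by have := normr_ge0 (f t); lra.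
move=> s; rewrite in_itv /= => /andP[us sv].
have : `|f s - f t| < 1.
  have [st|ts] := leP s t.
    have := H [:: (s, t)]; rewrite /= !big_seq1 /= distrC; apply => //.
      by rewrite st tb (le_trans au us).
    lra.
  have := H [:: (t, s)]; rewrite /= !big_seq1 /=; apply => //.
    by rewrite (ltW ts) at' (le_trans sv vb).
  lra.
have := ler_normD (f s - f t) (f t); rewrite subrK; lra.
Qed.

Definition lip a b f := exists2 L : R, 0 <= L &
  forall s t, s \in `[a, b] -> t \in `[a, b] -> `|f s - f t| <= L * `|s - t|.

Lemma lip_abs_cont a b f : lip a b f -> abs_cont a b f.
Proof.
move=> [L L0 H] e e0; exists (e / (L + 1)); first by rewrite divr_gt0 //; lra.
move=> n s s1 s2; rewrite ltr_pdivlMr; last lra.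
move=> s3; apply: le_lt_trans s3; rewrite mulr_suml; apply: ler_sum => i _.
have [h1 [h2 h3]] := s1 i.
have := H (s i).2 (s i).1; rewrite !in_itv /= h1 h3 (le_trans h1 h2) (le_trans h2 h3).
move=> /(_ isT isT) h; apply: le_trans h _.
rewrite ger0_norm; last by rewrite subr_ge0.
by rewrite mulrC ler_wpM2l //; lra.
Qed.

(** The bridge from absolutely continuous data to the Lipschitz calculus: the increment bound is
    used for [f] and for [- f]. *)
Lemma abs_cont_lip a b L f : 0 <= L -> abs_cont a b f ->
  aeI a b (fun t => exists2 v : R, is_derive t 1 f v & `|v| <= L) ->
  forall s t, s \in `[a, b] -> t \in `[a, b] -> `|f s - f t| <= L * `|s - t|.
Proof.
move=> L0 fac fd; suff main s t : a <= s -> s <= t -> t <= b -> `|f s - f t| <= L * `|s - t|.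
  move=> s t; rewrite !in_itv /= => /andP[as' sb] /andP[at' tb].
  have [st|ts] := leP s t; first exact: main.
  by rewrite distrC [`|s - t|]distrC; apply: main => //; exact: ltW.
move=> as' st tb; have fac' := abs_cont_sub as' tb fac.
have fd' := aeI_sub as' tb fd.
rewrite distrC [`|s - t|]distrC (ger0_norm (_ : 0 <= t - s)) ?subr_ge0 //.
rewrite ler_norml; apply/andP; split; last first.
  apply: abs_cont_le_derive => //; apply: aeI_imp fd' => r _ [v dv vL]; exists v => //.
  exact: le_trans (ler_norm _) vL.
have := @abs_cont_le_derive _ s t L _ st L0 (abs_contN fac').
rewrite opprK => H; suff : - f t + f s <= L * (t - s) by lra.
apply: H; apply: aeI_imp fd' => r _ [v dv vL]; exists (- v).
  exact: is_deriveN.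
by apply: le_trans (ler_norm _) _; rewrite normrN.
Qed.

Lemma lip_nonincreasing a b f : lip a b f ->
  aeI a b (fun t => exists2 v : R, is_derive t 1 f v & v <= 0) ->
  forall s t, a <= s -> s <= t -> t <= b -> f t <= f s.
Proof.
move=> fl fd s t as' st tb.
have := @abs_cont_le_derive _ s t 0 f st (lexx _)
  (abs_cont_sub as' tb (lip_abs_cont fl)) (aeI_sub as' tb fd).
by rewrite mul0r subr_le0.
Qed.

Lemma lip_bounded a b f : a <= b -> lip a b f ->
  exists2 M : R, 0 <= M & forall t, t \in `[a, b] -> `|f t| <= M.
Proof. by move=> ab /lip_abs_cont; exact: abs_cont_bounded. Qed.

Lemma lip_cst a b c : lip a b (fun=> c).
Proof. by exists 0 => // s t _ _; rewrite subrr normr0 mul0r. Qed.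

Lemma lip_id a b : lip a b id.
Proof. by exists 1 => // s t _ _; rewrite mul1r. Qed.

Lemma lipD a b f g : lip a b f -> lip a b g -> lip a b (fun t => f t + g t).
Proof.
move=> [L L0 Hf] [M M0 Hg]; exists (L + M); first exact: addr_ge0.
move=> s t sI tI; rewrite mulrDl.
have -> : f s + g s - (f t + g t) = (f s - f t) + (g s - g t) by ring.
apply: le_trans (ler_normD _ _) _.

by apply: lerD; [exact: Hf|exact: Hg].
Qed.

Lemma lipN a b f : lip a b f -> lip a b (fun t => - f t).
Proof.
by move=> [L L0 H]; exists L => // s t sI tI; rewrite -opprD normrN; exact: H.
Qed.

Lemma lipB a b f g : lip a b f -> lip a b g -> lip a b (fun t => f t - g t).
Proof. by move=> Hf Hg; apply: lipD => //; exact: lipN. Qed.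

Lemma lipM a b f g : a <= b -> lip a b f -> lip a b g -> lip a b (fun t => f t * g t).
Proof.
move=> ab Lf Lg; have [F F0 HF] := lip_bounded ab Lf; have [G G0 HG] := lip_bounded ab Lg.
move: Lf Lg => [L L0 Hf] [M M0 Hg]; exists (F * M + L * G).
  by rewrite addr_ge0 ?mulr_ge0.
move=> s t sI tI.
have -> : f s * g s - f t * g t = f s * (g s - g t) + (f s - f t) * g t by ring.
apply: le_trans (ler_normD _ _) _; rewrite !normrM [X in _ <= X]mulrDl; apply: lerD.
  by rewrite -mulrA; apply: ler_pM => //; [exact: HF|exact: Hg].
by rewrite mulrAC; apply: ler_pM => //; [exact: Hf|exact: HG].
Qed.

Lemma lip_sum a b n (f : 'I_n -> R -> R) : (forall i, lip a b (f i)) ->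
  lip a b (fun t => \sum_i f i t).
Proof.
elim: n f => [|n IH] f H.
  by under eq_fun do rewrite big_ord0; exact: lip_cst.
by under eq_fun do rewrite big_ord_recl; apply: lipD => //; exact: IH.
Qed.

Lemma lip_expR a b c : lip a b (fun t => expR (c * t)).
Proof.
have [M M0 HM] : exists2 M : R, 0 <= M & forall t, t \in `[a, b] -> expR (c * t) <= M.
  exists (expR (`|c| * (`|a| + `|b|))); first exact: expR_ge0.
  move=> t; rewrite in_itv /= => /andP[at' tb]; rewrite ler_expR.
  apply: le_trans (ler_norm _) _; rewrite normrM ler_wpM2l //.
  have := ler_norm b; have := ler_norm (- a); rewrite normrN.
  by have := normr_ge0 b; have := normr_ge0 a; rewrite ler_norml; lra.
(* The inequality [1 + x <= expR x] at [x = c * t - c * s] gives a one-sided bound; exchanging [s]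
   and [t] gives the other side. *)
have H s t : s \in `[a, b] -> expR (c * s) - expR (c * t) <= M * (`|c| * `|s - t|).
  move=> sI; have h : expR (c * s) * (1 + (c * t - c * s)) <= expR (c * t).
    have -> : expR (c * t) = expR (c * s) * expR (c * t - c * s).
      by rewrite -expRD addrC subrK.
    by apply: ler_wpM2l; [exact: expR_ge0|exact: expR_ge1Dx].
  apply: le_trans (_ : expR (c * s) * (c * (s - t)) <= _); first by lra.
  apply: le_trans (ler_norm _) _; rewrite !normrM; apply: ler_wpM2r.
    exact: mulr_ge0.
  by rewrite ger0_norm ?expR_ge0 //; exact: HM.
exists (M * `|c|); first exact: mulr_ge0.
move=> s t sI tI; rewrite -mulrA ler_norml; apply/andP; split; last exact: H.
by have := H t s tI; rewrite [`|t - s|]distrC; lra.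
Qed.

Lemma lip_within_continuous a b f : lip a b f -> {within `[a, b], continuous f}%classic.
Proof.
move=> [L L0 H]; apply/subspace_continuousP => x xI.
apply/cvgrPdist_lt => e e0; rewrite near_withinE.
have d0 : 0 < e / (L + 1) by rewrite divr_gt0 //; lra.
apply/nbhs_ballP; exists (e / (L + 1)) => // y; rewrite /ball /= => xy yI.
apply: le_lt_trans (H x y xI yI) _.
move: xy; rewrite ltr_pdivlMr; last lra.
by move=> h; apply: le_lt_trans h; rewrite mulrC ler_wpM2l //; lra.
Qed.

End RealLipschitz.

(** * Complex-valued functions of a real variable, with the real-valued modulus [normc] *)

Section ComplexCurves.
Context {R : realType}.
Local Notation C := (R[i]).
Local Notation Re := complex.Re.
Local Notation Im := complex.Im.
Local Notation normc := (@Normc.normc R).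
Implicit Types (a b t : R) (f g : R -> C) (z w v : C).

Lemma cReD z w : Re (z + w) = Re z + Re w. Proof. by case: z; case: w. Qed.
Lemma cImD z w : Im (z + w) = Im z + Im w. Proof. by case: z; case: w. Qed.
Lemma cReN z : Re (- z) = - Re z. Proof. by case: z. Qed.
Lemma cImN z : Im (- z) = - Im z. Proof. by case: z. Qed.
Lemma cReM z w : Re (z * w) = Re z * Re w - Im z * Im w.
Proof. by case: z; case: w. Qed.
Lemma cImM z w : Im (z * w) = Re z * Im w + Im z * Re w.
Proof. by case: z; case: w. Qed.
Lemma cReJ z : Re (z^*) = Re z. Proof. by case: z. Qed.
Lemma cImJ z : Im (z^*) = - Im z. Proof. by case: z. Qed.

Lemma cRe_sum n (F : 'I_n -> C) : Re (\sum_i F i) = \sum_i Re (F i).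
Proof. exact: (big_morph _ cReD). Qed.
Lemma cIm_sum n (F : 'I_n -> C) : Im (\sum_i F i) = \sum_i Im (F i).
Proof. exact: (big_morph _ cImD). Qed.

Lemma normc_ge0 z : 0 <= normc z. Proof. by case: z => x y; exact: sqrtr_ge0. Qed.
Lemma normc_sqr z : normc z ^+ 2 = Re z ^+ 2 + Im z ^+ 2.
Proof. by case: z => x y; rewrite sqr_sqrtr // addr_ge0 ?sqr_ge0. Qed.
Lemma Re_le_normc z : `|Re z| <= normc z.
Proof.
rewrite -(@ler_pXn2r _ 2) ?nnegrE ?normc_ge0 // normc_sqr real_normK ?num_real //.
by rewrite lerDl sqr_ge0.
Qed.
Lemma Im_le_normc z : `|Im z| <= normc z.
Proof.
rewrite -(@ler_pXn2r _ 2) ?nnegrE ?normc_ge0 // normc_sqr real_normK ?num_real //.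
by rewrite lerDr sqr_ge0.
Qed.
Lemma normc_le z : normc z <= `|Re z| + `|Im z|.
Proof.
rewrite -(@ler_pXn2r _ 2) ?nnegrE ?normc_ge0 ?addr_ge0 // normc_sqr.
rewrite sqrrD !real_normK ?num_real // lerD2r lerDl.
by rewrite mulrn_wge0 // mulr_ge0.
Qed.
Lemma normcD z w : normc (z + w) <= normc z + normc w.
Proof. exact: le_normcD. Qed.
Lemma normcB z w : normc (z - w) <= normc z + normc w.
Proof. by rewrite -[normc w]normcN; exact: le_normcD. Qed.
Lemma normc_sum n (F : 'I_n -> C) : normc (\sum_i F i) <= \sum_i normc (F i).
Proof.
elim/big_ind2 : _ => [|x y z w h1 h2|//]; first by rewrite Normc.normc0.
by apply: le_trans (normcD _ _) _; exact: lerD.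
Qed.
Lemma normc_cauchy z w : Re z * Re w + Im z * Im w <= normc z * normc w.
Proof.
have -> : normc z * normc w = normc (z^* * w).
  by rewrite Normc.normcM; congr (_ * _); case: z => x y /=; rewrite sqrrN.
apply: le_trans (le_trans (ler_norm _) (Re_le_normc _)).
by rewrite cReM cReJ cImJ mulNr opprK.
Qed.

(** The scalar form of [has_deriv_cv], convertible with each of its entries. *)
Definition derC f t v := is_derive t (1 : R) (fun s => Re (f s)) (Re v) /\
                         is_derive t (1 : R) (fun s => Im (f s)) (Im v).

Definition lipC a b f := lip a b (fun t => Re (f t)) /\ lip a b (fun t => Im (f t)).

Lemma derC_cst c t : derC (fun=> c) t 0.
Proof. by split; exact: is_derive_cst. Qed.

Lemma derCD f g t v w : derC f t v -> derC g t w -> derC (fun s => f s + g s) t (v + w).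
Proof.
move=> [h1 h2] [h3 h4]; split.
  by under eq_fun do rewrite cReD; rewrite cReD; exact: is_deriveD.
by under eq_fun do rewrite cImD; rewrite cImD; exact: is_deriveD.
Qed.

Lemma derCN f t v : derC f t v -> derC (fun s => - f s) t (- v).
Proof.
move=> [h1 h2]; split.
  by under eq_fun do rewrite cReN; rewrite cReN; exact: is_deriveN.
by under eq_fun do rewrite cImN; rewrite cImN; exact: is_deriveN.
Qed.

Lemma derCJ f t v : derC f t v -> derC (fun s => (f s)^*) t (v^*).
Proof.
move=> [h1 h2]; split.
  by under eq_fun do rewrite cReJ; rewrite cReJ.
by under eq_fun do rewrite cImJ; rewrite cImJ; exact: is_deriveN.
Qed.

Lemma is_deriveM' (h k : R -> R) t (dh dk : R) : is_derive t 1 h dh ->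
  is_derive t 1 k dk -> is_derive t 1 (fun s => h s * k s) (dh * k t + h t * dk).
Proof.
move=> H K; have /is_derive_eq := is_deriveM H K; apply.
by rewrite /GRing.scale /= addrC [k t * _]mulrC.
Qed.

Lemma derCM f g t v w : derC f t v -> derC g t w ->
  derC (fun s => f s * g s) t (v * g t + f t * w).
Proof.
move=> [h1 h2] [h3 h4]; split.
  under eq_fun do rewrite cReM; rewrite cReD !cReM.
  have /is_derive_eq := is_deriveB (is_deriveM' h1 h3) (is_deriveM' h2 h4); apply.
  ring.
under eq_fun do rewrite cImM; rewrite cImD !cImM.
have /is_derive_eq := is_deriveD (is_deriveM' h1 h4) (is_deriveM' h2 h3); apply.
ring.
Qed.

Lemma derC_sum n (F : 'I_n -> R -> C) t (v : 'I_n -> C) :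
  (forall i, derC (F i) t (v i)) -> derC (fun s => \sum_i F i s) t (\sum_i v i).
Proof.
elim: n F v => [|n IH] F v H.
  by under eq_fun do rewrite big_ord0; rewrite big_ord0; exact: derC_cst.
under eq_fun do rewrite big_ord_recl; rewrite big_ord_recl.
by apply: derCD => //; apply: IH => i; exact: H.
Qed.

Lemma derCZ c f t v : derC f t v -> derC (fun s => c * f s) t (c * v).
Proof. by move=> /(derCM (derC_cst c t)); rewrite mul0r add0r. Qed.

Lemma lipC_cst a b c : lipC a b (fun=> c).
Proof. by split; exact: lip_cst. Qed.

Lemma lipCD a b f g : lipC a b f -> lipC a b g -> lipC a b (fun s => f s + g s).
Proof.
move=> [h1 h2] [h3 h4]; split.
  by under eq_fun do rewrite cReD; exact: lipD.
by under eq_fun do rewrite cImD; exact: lipD.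
Qed.

Lemma lipCN a b f : lipC a b f -> lipC a b (fun s => - f s).
Proof.
move=> [h1 h2]; split.
  by under eq_fun do rewrite cReN; exact: lipN.
by under eq_fun do rewrite cImN; exact: lipN.
Qed.

Lemma lipCJ a b f : lipC a b f -> lipC a b (fun s => (f s)^*).
Proof.
move=> [h1 h2]; split.
  by under eq_fun do rewrite cReJ.
by under eq_fun do rewrite cImJ; exact: lipN.
Qed.

Lemma lipCM a b f g : a <= b -> lipC a b f -> lipC a b g ->
  lipC a b (fun s => f s * g s).
Proof.
move=> ab [h1 h2] [h3 h4]; split.
  by under eq_fun do rewrite cReM; apply: lipB; exact: lipM.
by under eq_fun do rewrite cImM; apply: lipD; exact: lipM.
Qed.

Lemma lipC_sum a b n (F : 'I_n -> R -> C) : (forall i, lipC a b (F i)) ->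
  lipC a b (fun s => \sum_i F i s).
Proof.
move=> H; split.
  by under eq_fun do rewrite cRe_sum; apply: lip_sum => i; case: (H i).
by under eq_fun do rewrite cIm_sum; apply: lip_sum => i; case: (H i).
Qed.

Lemma lipC_bounded a b f : a <= b -> lipC a b f ->
  exists2 M : R, 0 <= M & forall t, t \in `[a, b] -> normc (f t) <= M.
Proof.
move=> ab [/(lip_bounded ab) [M M0 HM] /(lip_bounded ab) [N N0 HN]].
exists (M + N); first exact: addr_ge0.
by move=> t tI; apply: le_trans (normc_le _) _; apply: lerD; [exact: HM|exact: HN].
Qed.

End ComplexCurves.

(** * Gronwall's inequality for systems with a bounded right-hand side *)

Section Gronwall.
Context {R : realType}.
Local Notation C := (R[i]).
Local Notation Re := complex.Re.
Local Notation Im := complex.Im.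
Local Notation normc := (@Normc.normc R).

(** [g] is the right-hand side already evaluated along [x]; homogeneous equations, equations with a
    source and differences of solutions all take this form. *)
Definition ode (a b : R) m (x g : R -> 'cV[C]_m) :=
  (forall i, lipC a b (fun t => x t i 0)) /\
  aeI a b (fun t => has_deriv_cv x t (g t)).

(** Cauchy-Schwarz against the all-ones vector, from [2 n_i n_j <= n_i^2 + n_j^2]. *)
Lemma sqr_sum_le m (n : 'I_m -> R) : (\sum_i n i) ^+ 2 <= m%:R * \sum_i n i ^+ 2.
Proof.
rewrite expr2 big_distrlr /=.
apply: (@le_trans _ _ (\sum_i \sum_j (n i ^+ 2 + n j ^+ 2) / 2)).
  apply: ler_sum => i _; apply: ler_sum => j _.
  by have := sqr_ge0 (n i - n j); rewrite sqrrB; lra.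
have -> : \sum_i \sum_j (n i ^+ 2 + n j ^+ 2) / 2 =
          \sum_(i < m) (m%:R * n i ^+ 2 / 2 + (\sum_j n j ^+ 2) / 2).
  apply: eq_bigr => i _; rewrite -mulr_suml big_split /= sumr_const card_ord.
  by rewrite -[_ *+ m]mulr_natl mulrDl.
rewrite big_split /= sumr_const card_ord -mulr_suml -mulr_sumr -[_ *+ m]mulr_natl.
by rewrite le_eqVlt; apply/orP; left; apply/eqP; field.
Qed.

(** The left side is the derivative of the squared norm of [x] along [x' = g]. The source enters
    through [2 gam |x_i| <= |x_i|^2 + gam^2], whence the summand 1; the linear part through
    [sqr_sum_le], whence [2 kap m]. *)
Lemma gronwall_energy m (x g : 'I_m -> C) (kap gam : R) : 0 <= kap ->
  (forall i, normc (g i) <= kap * (\sum_j normc (x j)) + gam) ->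
  Re (\sum_i ((g i)^* * x i + (x i)^* * g i)) <=
  (2 * kap * m%:R + 1) * (\sum_i normc (x i) ^+ 2) + m%:R * gam ^+ 2.
Proof.
move=> k0 Hg; set S := \sum_j normc (x j) in Hg.
apply: (@le_trans _ _ (\sum_i (2 * kap * S * normc (x i) + (normc (x i) ^+ 2 + gam ^+ 2)))).
  rewrite cRe_sum; apply: ler_sum => i _.
  rewrite cReD !cReM !cReJ !cImJ.
  have h1 := normc_cauchy (x i) (g i).
  have h2 := ler_wpM2l (normc_ge0 (x i)) (Hg i).
  by have := sqr_ge0 (normc (x i) - gam); rewrite sqrrB; lra.
rewrite !big_split /= sumr_const card_ord -mulr_sumr -/S.
have := sqr_sum_le (fun i => normc (x i)); rewrite -/S => h.
rewrite -[gam ^+ 2 *+ m]mulr_natl.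
have := ler_wpM2l k0 h; lra.
Qed.

Lemma is_derive_expRM (c t : R) :
  is_derive t 1 (fun s => expR (c * s)) (c * expR (c * t)).
Proof.
have h : is_derive t 1 (fun s : R => c * s) c.
  have /is_derive_eq := is_deriveM' (is_derive_cst c t (1:R)) (is_derive_id t (1 : R)).
  by apply; rewrite mul0r add0r mulr1.
have /is_derive_eq := is_derive1_comp (is_derive_expR (c * t)) h.
by apply; rewrite mulrC.
Qed.

(** [K] is chosen before the solution and the bounds [al], [gam]. Estimates uniform in the spectral
    parameter rest on this order of quantifiers. *)
Lemma gronwall a b m kap : a <= b -> 0 <= kap -> exists2 K : R, 0 <= K &
  forall (x g : R -> 'cV[C]_m) al gam, 0 <= al -> 0 <= gam -> ode a b x g ->
  aeI a b (fun t => forall i,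
    normc (g t i 0) <= kap * (\sum_j normc (x t j 0)) + gam) ->
  (forall i, normc (x a i 0) <= al) ->
  forall t i, t \in `[a, b] -> normc (x t i 0) <= K * (al + gam).
Proof.
move=> ab k0; pose c := 2 * kap * m%:R + 1.
have c0 : 0 <= c by rewrite addr_ge0 // !mulr_ge0.
(* The square of this constant absorbs [al^2 + gam^2 (b - a) <= (1 + (b - a)) (al + gam)^2]. *)
exists (Num.sqrt (expR (c * (b - a)) * (m%:R * (1 + (b - a))))); first exact: sqrtr_ge0.
move=> x g al gam al0 gam0 [xl xd] gb xa t i tI.
move: (tI); rewrite in_itv /= => /andP[at' tb].
pose E s := \sum_i normc (x s i 0) ^+ 2.
pose EC s : C := \sum_i (x s i 0)^* * x s i 0.
have EE : E = fun s => Re (EC s).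
  apply/funext => s; rewrite /E /EC cRe_sum; apply: eq_bigr => k _.
  by rewrite normc_sqr cReM cReJ cImJ mulNr opprK !expr2.
have El : lip a b E.
  rewrite EE; suff [] : lipC a b EC by [].
  by apply: lipC_sum => k; apply: lipCM => //; exact: lipCJ.
(* The linear term compensates the source: its contribution [m gam^2 expR (- c * s)] to the
   derivative is at most [m gam^2 expR (- c * a)], so [h] is nonincreasing. *)
pose h s := expR (- c * s) * E s - m%:R * gam ^+ 2 * expR (- c * a) * s.
have hl : lip a b h.
  apply: lipB; first by apply: lipM => //; exact: lip_expR.
  by apply: lipM => //; [exact: lip_cst|exact: lip_id].
have hd : aeI a b (fun s => exists2 v : R, is_derive s 1 h v & v <= 0).
  apply: aeI_mp gb _; apply: aeI_imp xd => s sI xs gs.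
  pose dE := Re (\sum_i ((g s i 0)^* * x s i 0 + (x s i 0)^* * g s i 0)).
  have Ed : is_derive s 1 E dE.
    rewrite EE; suff [] : derC EC s (\sum_i ((g s i 0)^* * x s i 0 + (x s i 0)^* * g s i
      0)) by [].
    by apply: derC_sum => k; apply: derCM; [apply: derCJ|]; exact: xs.
  have hd : is_derive s 1 h ((- c * expR (- c * s)) * E s + expR (- c * s) * dE - m%:R *
    gam ^+ 2 * expR (- c * a)).
    have d1 := is_deriveM' (is_derive_expRM (- c) s) Ed.
    have d2 := is_deriveM' (is_derive_cst (m%:R * gam ^+ 2 * expR (- c * a)) s (1:R))
      (is_derive_id s (1 : R)).
    have /is_derive_eq := is_deriveB d1 d2; apply.
    by rewrite mul0r add0r mulr1.
  eexists; first exact: hd.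
  have h1 := gronwall_energy k0 gs; rewrite -/dE -/c in h1.
  have h2 : expR (- c * s) * (dE - c * E s) <= expR (- c * s) * (m%:R * gam ^+ 2).
    by apply: ler_wpM2l; [exact: expR_ge0|rewrite /E; lra].
  have h3 : expR (- c * s) * (m%:R * gam ^+ 2) <= expR (- c * a) * (m%:R * gam ^+ 2).
    apply: ler_wpM2r; first by rewrite mulr_ge0 // sqr_ge0.
    by rewrite ler_expR !mulNr lerN2 ler_wpM2l //; move: sI; rewrite in_itv /= => /andP[].
  lra.
have := lip_nonincreasing hl hd (lexx a) at' tb.
rewrite /h => {hd}hd.
have Ea : E a <= m%:R * al ^+ 2.
  have -> : m%:R * al ^+ 2 = \sum_(k < m) al ^+ 2.
    by rewrite sumr_const card_ord mulr_natl.
  by apply: ler_sum => k _; rewrite ler_pXn2r ?nnegrE ?normc_ge0.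
have e0 := expR_gt0 (- c * a).
have Et : expR (- c * t) * E t <= expR (- c * a) * (m%:R * (al ^+ 2 + gam ^+ 2 * (b - a))).
  have := ler_wpM2l (ltW e0) Ea => h1.
  have h2 : expR (- c * a) * (m%:R * (gam ^+ 2 * (t - a))) <=
    expR (- c * a) * (m%:R * (gam ^+ 2 * (b - a))).
    apply: ler_wpM2l; first exact: ltW.
    by apply: ler_wpM2l => //; apply: ler_wpM2l; [exact: sqr_ge0|lra].
  lra.
have {}Et : E t <= expR (c * (b - a)) * (m%:R * (1 + (b - a))) * (al + gam) ^+ 2.
  have {Et} : E t <= expR (c * (t - a)) * (m%:R * (al ^+ 2 + gam ^+ 2 * (b - a))).
    have := ler_wpM2l (expR_ge0 (c * t)) Et.
    by rewrite !mulrA -!expRD mulNr subrr expR0 mul1r mulNr -mulrBr.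
  move=> h1; apply: le_trans h1 _; rewrite -[X in _ <= X]mulrA; apply: ler_pM.
  - exact: expR_ge0.
  - by apply: mulr_ge0 => //; apply: addr_ge0; [exact: sqr_ge0|apply: mulr_ge0;
    [exact: sqr_ge0|lra]].
  - by rewrite ler_expR; apply: ler_wpM2l => //; lra.
  rewrite -mulrA; apply: ler_wpM2l => //.
  have := mulr_ge0 al0 gam0; have := sqr_ge0 al; have := sqr_ge0 gam.
  have ba : 0 <= b - a by lra.
  move=> g2 a2 ag; have := mulr_ge0 ba a2; have := mulr_ge0 ba ag; rewrite sqrrD; lra.
rewrite -(@ler_pXn2r _ 2) ?nnegrE ?normc_ge0 ?mulr_ge0 ?sqrtr_ge0 ?addr_ge0 //.
rewrite exprMn sqr_sqrtr; last first.
  by rewrite !mulr_ge0 ?expR_ge0 // addr_ge0 // subr_ge0.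
apply: le_trans Et; rewrite /E (bigD1 i) //= lerDl sumr_ge0 // => k _; exact: sqr_ge0.
Qed.

End Gronwall.

(** * Limits of solutions *)

Section ParameterDependence.
Context {R : realType}.
Local Notation C := (R[i]).
Local Notation Re := complex.Re.
Local Notation Im := complex.Im.
Local Notation normc := (@Normc.normc R).

(** The intervals [[u n - e n, u n + e n]] meet pairwise, so the supremum of their left ends lies in
    all of them; the rate [e n] is kept. *)
Lemma cauchy_sup (u e : nat -> R) : (forall n k, `|u n - u k| <= e n + e k) ->
  exists l, forall n, `|u n - l| <= e n.
Proof.
move=> H; pose S : set R := fun y => exists n, y = u n - e n.
have ub k : ubound S (u k + e k).
  by move=> _ [n ->]; have := H n k; rewrite ler_norml => /andP[]; lra.
have S0 : (S !=set0)%classic by exists (u 0%N - e 0%N); exists 0%N.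
exists (sup S) => n; rewrite ler_norml.
have h1 : u n - e n <= sup S by apply: ub_le_sup; [exists (u 0%N + e 0%N)|exists n].
have h2 : sup S <= u n + e n by exact: ge_sup.
by lra.
Qed.

(** Termwise differentiation: [f n - f k] has derivative at most [e n + e k] almost everywhere, so
    it is Lipschitz with that constant, and in the limit [f n - F] is Lipschitz with constant [e n].
    This compares the difference quotients of [F] with those of [f n]. *)
Lemma is_derive_limit (a b : R) (f g : nat -> R -> R) (F G : R -> R) (e : nat -> R) :
  (forall n, 0 <= e n) -> (forall d : R, 0 < d -> exists n, e n <= d) ->
  (forall n, lip a b (f n)) ->
  (forall n t, t \in `[a, b] -> `|f n t - F t| <= e n) ->
  aeI a b (fun t => forall n, is_derive t 1 (f n) (g n t) /\ `|g n t - G t| <= e n) ->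
  lip a b F /\ aeI a b (fun t => is_derive t 1 F (G t)).
Proof.
move=> e0 elim fl fF fg.
have diff n s t : s \in `[a, b] -> t \in `[a, b] ->
    `|(f n s - F s) - (f n t - F t)| <= e n * `|s - t|.
  move=> sI tI.
  have H k : `|(f n s - f k s) - (f n t - f k t)| <= (e n + e k) * `|s - t|.
    apply: (@abs_cont_lip _ a b _ (fun r => f n r - f k r)) sI tI.
    - exact: addr_ge0.
    - by apply: lip_abs_cont; exact: lipB.
    apply: aeI_imp fg => r _ fr; have [dn hn] := fr n; have [dk hk] := fr k.
    exists (g n r - g k r); first exact: is_deriveB.
    have -> : g n r - g k r = (g n r - G r) - (g k r - G r) by ring.
    by apply: le_trans (ler_normB _ _) _; exact: lerD.
  apply/ler_addgt0Pr => d d0.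
  have st0 := normr_ge0 (s - t).
  have [k ek] : exists k, e k <= d / (`|s - t| + 2) by apply: elim; rewrite divr_gt0 //; lra.
  rewrite ler_pdivlMr in ek; last lra.
  have -> : f n s - F s - (f n t - F t) =
    ((f n s - f k s) - (f n t - f k t)) + ((f k s - F s) - (f k t - F t)) by ring.
  apply: le_trans (ler_normD _ _) _.
  have := H k; have := le_trans (ler_normB (f k s - F s) (f k t - F t)) (lerD (fF k s sI)
    (fF k t tI)).
  rewrite mulrDl; lra.
split.
  have [L L0 HL] := fl 0%N; exists (L + e 0%N); first exact: addr_ge0.
  move=> s t sI tI; rewrite mulrDl.
  have -> : F s - F t = (f 0%N s - f 0%N t) - ((f 0%N s - F s) - (f 0%N t - F t)) by ring.
  by apply: le_trans (ler_normB _ _) _; apply: lerD; [exact: HL|exact: diff].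
apply: aeI_mp fg _; apply: aeI_imp (aeI_oo a b) => t tI toI fg.
apply: lin_approx_is_derive => d d0.
(* Three errors are added: the linear approximation of [f n], the Lipschitz error of [f n - F], and
   [g n t - G t]. *)
have d4 : 0 < d / 4 by lra.
have [n en] := elim _ d4; have [/is_derive_lin_approx fd gd] := fg n.
have [del del0 Hdel] := fd _ d4.
move: toI; rewrite in_itv /= => /andP[ta tb].
exists (Num.min del (Num.min (t - a) (b - t))).
  by rewrite !lt_min del0 !subr_gt0 ta tb.
move=> s; rewrite !lt_min => /and3P[s1 s2 s3].
have sI : s \in `[a, b].
  by move: s2 s3; rewrite in_itv /= !ltr_norml => /andP[? ?] /andP[? ?]; apply/andP;
    split; lra.
have -> : F s - F t - G t * (s - t) = (f n s - f n t - g n t * (s - t))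
   - ((f n s - F s) - (f n t - F t)) + (g n t - G t) * (s - t) by ring.
apply: le_trans (ler_normD _ _) _; rewrite normrM.
have h1 := ler_normB (f n s - f n t - g n t * (s - t)) ((f n s - F s) - (f n t - F t)).
have h2 := Hdel s s1; have h3 := diff n s t sI tI.
have st0 := normr_ge0 (s - t).
have h4 := ler_wpM2r st0 gd; have h5 := ler_wpM2r st0 en.
have h6 := mulr_ge0 (ltW d0) st0; lra.
Qed.

Lemma ode_eq (a b : R) m (x g g' : R -> 'cV[C]_m) :
  ode a b x g -> aeI a b (fun t => g t = g' t) -> ode a b x g'.
Proof.
move=> [xl xd] gg; split => //; apply: aeI_mp gg _.
by apply: aeI_imp xd => t _ xt <-.
Qed.

Lemma odeD (a b : R) m (x y g h : R -> 'cV[C]_m) : ode a b x g -> ode a b y h ->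
  ode a b (fun t => x t + y t) (fun t => g t + h t).
Proof.
move=> [xl xd] [yl yd]; split.
  by move=> i; under eq_fun do rewrite mxE; exact: lipCD.
apply: aeI_mp xd _; apply: aeI_imp yd => t _ yt xt i.
rewrite mxE; rewrite -/(derC (fun s => (x s + y s) i 0) t (g t i 0 + h t i 0)).
by under eq_fun do rewrite mxE; apply: derCD; [exact: xt|exact: yt].
Qed.

Lemma odeZ (a b : R) m c (x g : R -> 'cV[C]_m) : a <= b -> ode a b x g ->
  ode a b (fun t => c *: x t) (fun t => c *: g t).
Proof.
move=> ab [xl xd]; split.
  by move=> i; under eq_fun do rewrite mxE; apply: lipCM => //; exact: lipC_cst.
apply: aeI_imp xd => t _ xt i.
rewrite mxE; rewrite -/(derC (fun s => (c *: x s) i 0) t (c * g t i 0)).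
by under eq_fun do rewrite mxE; apply: derCZ; exact: xt.
Qed.

Lemma odeB (a b : R) m (x y g h : R -> 'cV[C]_m) : a <= b -> ode a b x g -> ode a b y h ->
  ode a b (fun t => x t - y t) (fun t => g t - h t).
Proof.
move=> ab xg yh; have := odeD xg (odeZ (-1) ab yh).
by under eq_fun do rewrite scaleN1r; under [X in ode _ _ _ X]eq_fun do rewrite scaleN1r.
Qed.

Lemma ode_col (a b : R) m n (x g : R -> 'cV[C]_m) (y h : R -> 'cV[C]_n) :
  ode a b x g -> ode a b y h ->
  ode a b (fun t => col_mx (x t) (y t)) (fun t => col_mx (g t) (h t)).
Proof.
move=> [xl xd] [yl yd]; split.
  by move=> i; case: (split_ordP i) => j ->; under eq_fun do rewrite ?col_mxEu ?col_mxEd.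
apply: aeI_mp xd _; apply: aeI_imp yd => t _ yt xt i.
rewrite -/(derC (fun s => col_mx (x s) (y s) i 0) t (col_mx (g t) (h t) i 0)).
case: (split_ordP i) => j ->.
  by under eq_fun do rewrite col_mxEu; rewrite col_mxEu; exact: xt.
by under eq_fun do rewrite col_mxEd; rewrite col_mxEd; exact: yt.
Qed.

Lemma ode_limit (a b : R) m (x g : nat -> R -> 'cV[C]_m) (X G : R -> 'cV[C]_m) (e :
  nat -> R) :
  (forall n, 0 <= e n) -> (forall d : R, 0 < d -> exists n, e n <= d) ->
  (forall n, ode a b (x n) (g n)) ->
  (forall n t i, t \in `[a, b] -> normc (x n t i 0 - X t i 0) <= e n) ->
  aeI a b (fun t => forall n i, normc (g n t i 0 - G t i 0) <= e n) ->
  ode a b X G.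
Proof.
move=> e0 elim xg xX gG.
have xd : aeI a b (fun t => forall n, has_deriv_cv (x n) t (g n t)).
  by apply: aeI_nat => n; case: (xg n).
have HR i : lip a b (fun t => Re (X t i 0)) /\
   aeI a b (fun t => is_derive t (1:R) (fun s => Re (X s i 0)) (Re (G t i 0))).
  apply: (@is_derive_limit a b (fun n t => Re (x n t i 0)) (fun n t => Re (g n t i 0)) _
    _ e) => //.
  - by move=> n; case: (xg n) => /(_ i) [].
  - move=> n t tI; apply: le_trans (xX n t i tI).
    by apply: le_trans (Re_le_normc _); rewrite cReD cReN.
  apply: aeI_mp gG _; apply: aeI_imp xd => t _ xt gt n.
  split; first by case: (xt n i).
  by apply: le_trans (gt n i); apply: le_trans (Re_le_normc _); rewrite cReD cReN.
have HI i : lip a b (fun t => Im (X t i 0)) /\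
   aeI a b (fun t => is_derive t (1:R) (fun s => Im (X s i 0)) (Im (G t i 0))).
  apply: (@is_derive_limit a b (fun n t => Im (x n t i 0)) (fun n t => Im (g n t i 0)) _
    _ e) => //.
  - by move=> n; case: (xg n) => /(_ i) [].
  - move=> n t tI; apply: le_trans (xX n t i tI).
    by apply: le_trans (Im_le_normc _); rewrite cImD cImN.
  apply: aeI_mp gG _; apply: aeI_imp xd => t _ xt gt n.
  split; first by case: (xt n i).
  by apply: le_trans (gt n i); apply: le_trans (Im_le_normc _); rewrite cImD cImN.
split; first by move=> i; split; [case: (HR i)|case: (HI i)].
apply: aeI_fin => i; apply: aeI_and; [by case: (HR i)|by case: (HI i)].
Qed.

End ParameterDependence.

(** * Differentiability of solutions in the spectral parameter *)

Section ParameterDerivative.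
Context {R : realType}.
Local Notation C := (R[i]).
Local Notation normc := (@Normc.normc R).
Variables (a b : R).
Hypothesis ab : a <= b.

Definition bounded_mx m n (K : R -> 'M[C]_(m, n)) :=
  exists2 k : R, 0 <= k & aeI a b (fun t => forall i j, normc (K t i j) <= k).

Lemma normc_mulmx_le m (K : 'M[C]_m) (x : 'cV[C]_m) k i :
  (forall i j, normc (K i j) <= k) -> normc ((K *m x) i 0) <= k * \sum_j normc (x j 0).
Proof.
move=> Kk; rewrite mxE mulr_sumr; apply: le_trans (normc_sum _) _.
by apply: ler_sum => j _; rewrite Normc.normcM ler_wpM2r ?normc_ge0.
Qed.

(** The coefficient matrix is affine in the parameter and the initial value does not depend on it,
    so derivatives in the parameter vanish at [a]. *)
Definition param_sys m (K0 K1 : R -> 'M[C]_m) (x : C -> R -> 'cV[C]_m) :=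
  [/\ bounded_mx K0, bounded_mx K1,
      forall l, ode a b (x l) (fun t => (K0 t + l *: K1 t) *m x l t) &
      forall l l', x l a = x l' a].

Variables (m : nat) (K0 K1 : R -> 'M[C]_m) (x : C -> R -> 'cV[C]_m).
Hypothesis sys : param_sys K0 K1 x.

Lemma pencil_bound (L : R) : 0 <= L -> exists2 k : R, 0 <= k &
  aeI a b (fun t => forall l, normc l <= L -> forall i j,
    normc ((K0 t + l *: K1 t) i j) <= k).
Proof.
case: sys => [[k0 k00 H0] [k1 k10 H1] _ _] L0.
exists (k0 + L * k1); first by rewrite addr_ge0 ?mulr_ge0.
apply: aeI_mp H1 _; apply: aeI_imp H0 => t _ h0 h1 l lL i j.
rewrite !mxE; apply: le_trans (normcD _ _) _; apply: lerD => //.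
by rewrite Normc.normcM; apply: ler_pM; rewrite ?normc_ge0.
Qed.

Lemma param_bound (L : R) : 0 <= L -> exists2 M : R, 0 <= M &
  forall l t i, normc l <= L -> t \in `[a, b] -> normc (x l t i 0) <= M.
Proof.
move=> L0; have [k k0 Hk] := pencil_bound L0.
have [G G0 HG] := gronwall m ab k0.
pose al := \sum_i normc (x 0 a i 0).
have al0 : 0 <= al by apply: sumr_ge0 => i _; exact: normc_ge0.
exists (G * (al + 0)); first by rewrite mulr_ge0 // addr0.
move=> l t i lL tI; case: sys => _ _ xo xa.
apply: (HG _ _ _ _ al0 (lexx _) (xo l)) => //.
  by apply: aeI_imp Hk => s _ hs j; rewrite addr0; apply: normc_mulmx_le; exact: hs.
move=> j; rewrite (xa l 0) /al (bigD1 j) //= lerDl.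
by apply: sumr_ge0 => k' _; exact: normc_ge0.
Qed.

(** The difference of two solutions vanishes at [a] and solves the system for [l] with source
    [(l - l') K1 x_l'], which is bounded by [param_bound]; Gronwall's inequality concludes. *)
Lemma param_lip (L : R) : 0 <= L -> exists2 M : R, 0 <= M &
  forall l l' t i, normc l <= L -> normc l' <= L -> t \in `[a, b] ->
  normc (x l t i 0 - x l' t i 0) <= M * normc (l - l').
Proof.
move=> L0; have [k k0 Hk] := pencil_bound L0.
have [M M0 HM] := param_bound L0.
have [G G0 HG] := gronwall m ab k0.
case: (sys) => _ [k1 k10 H1] xo xa.
exists (G * (k1 * (m%:R * M))); first by rewrite !mulr_ge0.
move=> l l' t i lL lL' tI.
pose g t := (K0 t + l *: K1 t) *m (x l t - x l' t) + (l - l') *: (K1 t *m x l' t).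
have og : ode a b (fun t => x l t - x l' t) g.
  apply: ode_eq (odeB ab (xo l) (xo l')) _; apply: aeI_all => s _; rewrite /g.
  rewrite mulmxBr -addrA; congr (_ + _).
  by rewrite !mulmxDl -!scalemxAl scalerBl !opprD -!addrA addKr.
have := HG _ _ 0 (normc (l - l') * (k1 * (m%:R * M))) (lexx _) _ og _ _ t i tI.
rewrite mxE mxE add0r => H; apply: le_trans (H _ _ _) _.
- by rewrite !mulr_ge0 ?normc_ge0.
- apply: aeI_mp H1 _; apply: aeI_imp Hk => s sI hk h1 j.
  rewrite /g mxE; apply: le_trans (normcD _ _) _; apply: lerD.
    by apply: normc_mulmx_le; exact: hk.
  rewrite mxE Normc.normcM ler_wpM2l ?normc_ge0 //.
  apply: le_trans (normc_mulmx_le _ _ h1) _; rewrite ler_wpM2l //.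
  have -> : m%:R * M = \sum_(j < m) M by rewrite sumr_const card_ord mulr_natl.
  by apply: ler_sum => j' _; exact: HM.
- by move=> j; rewrite (xa l l') subrr mxE Normc.normc0.
by rewrite le_eqVlt; apply/orP; left; apply/eqP; ring.
Qed.

Let D l h t : 'cV[C]_m := h^-1 *: (x (l + h) t - x l t).

Let D_ode l h : h != 0 ->
  ode a b (D l h) (fun t => (K0 t + l *: K1 t) *m D l h t + K1 t *m x (l + h) t).
Proof.
move=> h0; case: sys => _ _ xo xa.
apply: ode_eq (odeZ h^-1 ab (odeB ab (xo (l + h)) (xo l))) _; apply: aeI_all => t _.
rewrite /D -scalemxAr mulmxBr.
have -> : K1 t *m x (l + h) t = h^-1 *: (h *: (K1 t *m x (l + h) t)).
  by rewrite scalerA mulVf // scale1r.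
rewrite -scalerDr; congr (_ *: _).
by rewrite addrAC; congr (_ - _); rewrite !mulmxDl -!scalemxAl scalerDl addrA.
Qed.

(** The difference of two quotients vanishes at [a] and solves the system for [l] with source
    [K1 (x_(l+h) - x_(l+h'))], of size [|h - h'|] by [param_lip]. Steps of modulus at most 1 keep
    the parameters in the disc of radius [normc l + 1]. *)
Lemma quotient_cauchy l : exists2 M : R, 0 <= M &
  forall h h' t, h != 0 -> h' != 0 -> normc h <= 1 -> normc h' <= 1 -> t \in `[a, b] ->
  forall i, normc (D l h t i 0 - D l h' t i 0) <= M * normc (h - h').
Proof.
have L0 : 0 <= normc l + 1 by rewrite addr_ge0 ?normc_ge0.
have [k k0 Hk] := pencil_bound L0.
have [M M0 HM] := param_lip L0.
have [G G0 HG] := gronwall m ab k0.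
case: (sys) => _ [k1 k10 H1] xo xa.
exists (G * (k1 * (m%:R * M))); first by rewrite !mulr_ge0.
move=> h h' t h0 h0' h1 h1' tI i.
pose g t := (K0 t + l *: K1 t) *m (D l h t - D l h' t) + K1 t *m (x (l + h) t - x (l + h') t).
have og : ode a b (fun t => D l h t - D l h' t) g.
  apply: ode_eq (odeB ab (D_ode l h0) (D_ode l h0')) _; apply: aeI_all => s _; rewrite /g.
  by rewrite !mulmxBr opprD addrACA.
have := HG _ _ 0 (normc (h - h') * (k1 * (m%:R * M))) (lexx _) _ og _ _ t i tI.
rewrite add0r => H.
have -> : D l h t i 0 - D l h' t i 0 = (D l h t - D l h' t) i 0 by rewrite !mxE.
apply: le_trans (H _ _ _) _.
- by rewrite !mulr_ge0 ?normc_ge0.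
- apply: aeI_mp H1 _; apply: aeI_imp Hk => s sI hk hk1 j.
  rewrite /g mxE; apply: le_trans (normcD _ _) _; apply: lerD.
    by apply: normc_mulmx_le => *; apply: hk; rewrite lerDl.
  apply: le_trans (normc_mulmx_le _ _ hk1) _.
  rewrite [X in _ <= X](_ : _ = k1 * (m%:R * (M * normc (h - h')))); last by ring.
  rewrite ler_wpM2l //.
  have -> : m%:R * (M * normc (h - h')) = \sum_(j < m) (M * normc (h - h')).
    by rewrite sumr_const card_ord mulr_natl.
  apply: ler_sum => j' _; rewrite !mxE.
  have -> : h - h' = (l + h) - (l + h') by rewrite opprD addrACA subrr add0r.
  apply: HM => //; apply: le_trans (normcD _ _) _; by rewrite lerD2l.
- by move=> j; rewrite /D !(xa _ l) !subrr !scaler0 subrr mxE Normc.normc0.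
by rewrite le_eqVlt; apply/orP; left; apply/eqP; ring.
Qed.

(* The difference quotients are uniformly Cauchy by Gronwall's inequality, hence so
   are their derivatives in [t], and the limit solves the limit equation. *)
Lemma param_derive_at (l : C) : exists y : R -> 'cV[C]_m,
  [/\ y a = 0,
      ode a b y (fun t => (K0 t + l *: K1 t) *m y t + K1 t *m x l t) &
      forall t i, t \in `[a, b] ->
        lin_approx (fun l' : C => x l' t i 0) l (y t i 0)].
Proof.
have [M M0 HM] := quotient_cauchy l.
(* Real steps [1 / (n + 1)] suffice to find the limit; [yD] extends the estimate to all small
   complex steps. *)
pose hn n : C := (n.+1%:R^-1 : R)%:C%C.
have hn0 n : hn n != 0 by rewrite /hn fmorph_eq0 invr_eq0 pnatr_eq0.
have hnE n : normc (hn n) = n.+1%:R^-1.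
  by rewrite /hn /= expr0n /= addr0 sqrtr_sqr ger0_norm // invr_ge0.
have hn1 n : normc (hn n) <= 1 by rewrite hnE invf_le1 // ler1n.
pose e n : R := M * n.+1%:R^-1.
have e0 n : 0 <= e n by rewrite mulr_ge0 // invr_ge0.
have elim (d : R) : 0 < d -> exists n, e n <= d.
  move=> d0; exists (Num.truncn (M / d)); rewrite /e ler_pdivrMr // mulrC -ler_pdivrMr //.
  by apply: ltW; apply: truncnS_gt.
have Dn n k t i : t \in `[a, b] -> normc (D l (hn n) t i 0 - D l (hn k) t i 0) <= e n + e k.
  move=> tI; apply: le_trans (HM _ _ t (hn0 n) (hn0 k) (hn1 n) (hn1 k) tI i) _.
  rewrite -mulrDr ler_wpM2l // -!hnE; exact: normcB.
(* The factor 2 adds the errors of the real and the imaginary part. *)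
have /choice [y Hy] : forall t, exists v : 'cV[C]_m, t \in `[a, b] ->
    forall n i, normc (D l (hn n) t i 0 - v i 0) <= 2 * e n.
  move=> t; have [tI|tI] := boolP (t \in `[a, b]); last by exists 0.
  have /choice [v Hv] : forall i, exists z :
    C, forall n, normc (D l (hn n) t i 0 - z) <= 2 * e n.
    move=> i.
    have [|r Hr] := @cauchy_sup R (fun n => complex.Re (D l (hn n) t i 0)) e.
      move=> n k; apply: le_trans (Dn n k t i tI); apply: le_trans (Re_le_normc _).
      by rewrite cReD cReN.
    have [|s Hs] := @cauchy_sup R (fun n => complex.Im (D l (hn n) t i 0)) e.
      move=> n k; apply: le_trans (Dn n k t i tI); apply: le_trans (Im_le_normc _).
      by rewrite cImD cImN.
    exists (Complex r s) => n; apply: le_trans (normc_le _) _.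
    by rewrite cReD cReN cImD cImN /= mulr_natl mulr2n lerD.
  by exists (\col_i v i) => _ n i; rewrite mxE.
have yD h t i : h != 0 -> normc h <= 1 -> t \in `[a, b] ->
    normc (D l h t i 0 - y t i 0) <= M * normc h.
  move=> h0 h1 tI; apply/ler_addgt0Pr => d d0.
  have [|n en] := elim (d / 3); first by lra.
  have -> : D l h t i 0 - y t i 0 =
    (D l h t i 0 - D l (hn n) t i 0) + (D l (hn n) t i 0 - y t i 0) by rewrite addrA subrK.
  apply: le_trans (normcD _ _) _.
  have q1 := HM _ _ t h0 (hn0 n) h1 (hn1 n) tI i; have q2 := Hy t tI n i.
  have q3 := ler_wpM2l M0 (normcB h (hn n)); rewrite hnE mulrDr -/(e n) in q3.
  lra.
case: (sys) => K0b [k1 k10 H1] xo xa.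
have L0 : 0 <= normc l + 1 by rewrite addr_ge0 ?normc_ge0.
have [k k0 Hk] := pencil_bound L0.
have [N N0 HN] := param_lip L0.
have aI : a \in `[a, b] by rewrite in_itv /= lexx ab.
exists y; split.
- apply/matrixP => i j; rewrite ord1 mxE; apply: Normc.eq0_normc; apply/eqP.
  rewrite eq_le normc_ge0 andbT; apply/ler_addgt0Pr => d d0; rewrite add0r.
  have [|n en] := elim (d / 2); first by lra.
  have := Hy a aI n i; rewrite /D (xa _ l) subrr scaler0 mxE sub0r normcN; lra.
(* One rate must serve the quotients and their derivatives in [t]: the summand 2 is for the former,
   the other two bound the errors through [K0 + l K1] and through [K1]. *)
- pose c : R := 2 + k * m%:R * 2 + k1 * m%:R * N.
  have e'0 n : 0 <= c * (M * n.+1%:R^-1 + n.+1%:R^-1).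
    by rewrite mulr_ge0 ?addr_ge0 ?mulr_ge0 ?invr_ge0.
  apply: (@ode_limit R a b m (fun n => D l (hn n)) _ _ _ (fun n => c * (M * n.+1%:R^-1 +
    n.+1%:R^-1))
     e'0 _ (fun n => D_ode l (hn0 n))).
  + move=> d d0; exists (Num.truncn (c * (M + 1) / d)).
    set i := (_.+1%:R)^-1; have -> : c * (M * i + i) = c * (M + 1) * i by ring.
    rewrite /i ler_pdivrMr // [d * _]mulrC -ler_pdivrMr //.
    by apply: ltW; apply: truncnS_gt.
  + move=> n t i tI; apply: le_trans (Hy t tI n i) _; rewrite /e /c.
    have i0 : 0 <= n.+1%:R^-1 :> R by rewrite invr_ge0.
    rewrite -subr_ge0; set r : R := _^-1 in i0 *.
    have -> : (2 + k * m%:R * 2 + k1 * m%:R * N) * (M * r + r) - 2 * (M * r) =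
      2 * r + (k * m%:R * 2 + k1 * m%:R * N) * (M * r + r) by ring.
    by do ?[apply: addr_ge0|apply: mulr_ge0|].
  apply: aeI_mp H1 _; apply: aeI_imp Hk => t tI hk hk1 n i.
  have -> : ((K0 t + l *: K1 t) *m D l (hn n) t + K1 t *m x (l + hn n) t) i 0 -
      ((K0 t + l *: K1 t) *m y t + K1 t *m x l t) i 0 =
      ((K0 t + l *: K1 t) *m (D l (hn n) t - y t)) i 0 +
      (K1 t *m (x (l + hn n) t - x l t)) i 0.
    have aux (A B A' B' : 'cV[C]_m) :
      (A + B) i 0 - (A' + B') i 0 = (A - A') i 0 + (B - B') i 0 by rewrite !mxE; ring.
    by rewrite aux -!mulmxBr.
  apply: le_trans (normcD _ _) _.
  have q1 := @normc_mulmx_le m _ (D l (hn n) t - y t) k i (hk l _).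
  have q2 := normc_mulmx_le (x (l + hn n) t - x l t) i hk1.
  have q3 : \sum_j normc ((D l (hn n) t - y t) j 0) <= m%:R * (2 * e n).
    have -> : m%:R * (2 * e n) = \sum_(j < m) (2 * e n) by rewrite sumr_const card_ord
      mulr_natl.
    apply: ler_sum => j _; have := Hy t tI n j; congr (normc _ <= _).
    by rewrite [RHS]mxE [X in _ = _ + X]mxE.
  have q4 : \sum_j normc ((x (l + hn n) t - x l t) j 0) <= m%:R * (N * n.+1%:R^-1).
    have -> : m%:R * (N * n.+1%:R^-1) = \sum_(j < m) (N * n.+1%:R^-1 :
      R) by rewrite sumr_const card_ord mulr_natl.
    apply: ler_sum => j _; rewrite !mxE -hnE.
    have := HN (l + hn n) l t j; rewrite [l + _ - l]addrC addKr; apply => //.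
      by apply: le_trans (normcD _ _) _; rewrite lerD2l.
    by rewrite lerDl.
  have {}q1 := le_trans (q1 (ler_wpDr ler01 (lexx _))) (ler_wpM2l k0 q3).
  have {}q2 := le_trans q2 (ler_wpM2l k10 q4).
  apply: le_trans (lerD q1 q2) _; rewrite /e /c.
  have i0 : 0 <= n.+1%:R^-1 :> R by rewrite invr_ge0.
  rewrite -subr_ge0; set r : R := _^-1 in i0 *.
  have -> : (2 + k * m%:R * 2 + k1 * m%:R * N) * (M * r + r) -
      (k * (m%:R * (2 * (M * r))) + k1 * (m%:R * (N * r))) =
      2 * (M * r + r) + k * m%:R * 2 * r + k1 * m%:R * N * (M * r) by ring.
  by do ?[apply: addr_ge0|apply: mulr_ge0|].
- move=> t i tI d d0.
  have normE (z : C) : `|z| = (normc z)%:C%C by case: z.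
  have [dr dE] : exists dr : R, d = dr%:C%C.
    by exists (complex.Re d); rewrite RRe_real // gtr0_real.
  rewrite dE ltcR in d0 *.
  exists ((Num.min 1 (dr / (M + 1)))%:C%C).
    by rewrite ltcR lt_min ltr01 divr_gt0 //; lra.
  move=> l'; rewrite !normE ltcR -rmorphM /= lecR lt_min => /andP[h1 h2].
  have [->|nl] := eqVneq l' l.
    by rewrite !subrr mulr0 subr0 Normc.normc0 mulr0.
  have h0 : l' - l != 0 by rewrite subr_eq0.
  have := yD (l' - l) t i h0 (ltW h1) tI.
  have -> : x l' t i 0 - x l t i 0 - y t i 0 * (l' - l) =
    (l' - l) * (D l (l' - l) t i 0 - y t i 0).
    by rewrite /D !mxE [l + _]addrC subrK [RHS]mulrBr mulrA divff // mul1r [y t i 0 * _]mulrC.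
  rewrite Normc.normcM => q; rewrite mulrC ler_wpM2r ?normc_ge0 //.
  apply: le_trans q _; rewrite ltr_pdivlMr in h2; last lra.
  by apply: le_trans (ltW h2); rewrite mulrC ler_wpM2l ?normc_ge0 //; lra.
Qed.

End ParameterDerivative.

(** * Orders of zeros of smooth functions, products and determinants *)

Section OrderOfVanishing.
Variable K : numFieldType.
Implicit Types (f g : K -> K) (z c : K).

(** The derivative is an argument, so differentiability is part of the statement and no default
    value intervenes. *)
Definition deriv_fun f f' := forall z, lin_approx f z (f' z).

Lemma deriv_fun_is_derive f f' z : deriv_fun f f' -> is_derive z 1 (f : K -> K^o) (f' z).
Proof. by move=> H; apply: lin_approx_is_derive; exact: H. Qed.

Lemma deriv_fun_unique f f' f'' : deriv_fun f f' -> deriv_fun f f'' -> f' = f''.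
Proof.
move=> H1 H2; apply/funext => z.
have [_ <-] := deriv_fun_is_derive z H1.
by have [_ <-] := deriv_fun_is_derive z H2.
Qed.

Lemma deriv_fun_cst c : deriv_fun (fun=> c) (fun=> 0).
Proof. by move=> z; apply: is_derive_lin_approx; exact: is_derive_cst. Qed.

Lemma deriv_funD f g f' g' : deriv_fun f f' -> deriv_fun g g' ->
  deriv_fun (fun z => f z + g z) (fun z => f' z + g' z).
Proof.
move=> H1 H2 z; apply: is_derive_lin_approx.
exact: (is_deriveD (deriv_fun_is_derive z H1) (deriv_fun_is_derive z H2)).
Qed.

Lemma deriv_funM f g f' g' : deriv_fun f f' -> deriv_fun g g' ->
  deriv_fun (fun z => f z * g z) (fun z => f' z * g z + f z * g' z).
Proof.
move=> H1 H2 z; apply: is_derive_lin_approx.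
have /is_derive_eq := is_deriveM (deriv_fun_is_derive z H1) (deriv_fun_is_derive z H2).
by apply; rewrite /GRing.scale /= addrC [g z * _]mulrC.
Qed.

Fixpoint Cn N f : Prop :=
  if N is N'.+1 then exists2 f', deriv_fun f f' & Cn N' f' else True.

Definition smooth f := forall N, Cn N f.

Lemma Cn_pred N f : Cn N.+1 f -> Cn N f.
Proof.
elim: N f => [//|N IH] f [f' ff' Hf']; exists f' => //; exact: IH.
Qed.

Lemma Cn_cst N c : Cn N (fun=> c).
Proof. by elim: N c => [//|N IH] c; exists (fun=> 0) => //; exact: deriv_fun_cst. Qed.

Lemma CnD N f g : Cn N f -> Cn N g -> Cn N (fun z => f z + g z).
Proof.
elim: N f g => [//|N IH] f g [f' h1 h2] [g' h3 h4].
by eexists; [exact: deriv_funD h1 h3|exact: IH].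
Qed.

Lemma CnM N f g : Cn N f -> Cn N g -> Cn N (fun z => f z * g z).
Proof.
elim: N f g => [//|N IH] f g Hf Hg; have [f' h1 h2] := Hf; have [g' h3 h4] := Hg.
eexists; first exact: deriv_funM h1 h3.
by apply: CnD; apply: IH => //; exact: Cn_pred.
Qed.

Lemma smooth_cst c : smooth (fun=> c). Proof. by move=> N; exact: Cn_cst. Qed.
Lemma smoothD f g : smooth f -> smooth g -> smooth (fun z => f z + g z).
Proof. by move=> Hf Hg N; exact: CnD. Qed.
Lemma smoothM f g : smooth f -> smooth g -> smooth (fun z => f z * g z).
Proof. by move=> Hf Hg N; exact: CnM. Qed.

(** [Cn] may choose a different derivative for each [N]; uniqueness identifies these choices. *)
Lemma smooth_deriv f : smooth f -> exists2 f', deriv_fun f f' & smooth f'.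
Proof.
move=> Hf; have [f' ff' _] := Hf 1%N; exists f' => // N.
by have [f'' ff'' Hf''] := Hf N.+1; rewrite (deriv_fun_unique ff' ff'').
Qed.

Lemma smooth_sum (I : Type) (r : seq I) (F : I -> K -> K) :
  (forall i, smooth (F i)) -> smooth (fun z => \sum_(i <- r) F i z).
Proof.
move=> H; elim: r => [|i r IH].
  by under eq_fun do rewrite big_nil; exact: smooth_cst.
by under eq_fun do rewrite big_cons; exact: smoothD.
Qed.

Variable z0 : K.

(* [f(z) = c (z - z0)^n + o((z - z0)^n)] *)
Fixpoint leading n f c : Prop :=
  if n is n'.+1 then
    f z0 = 0 /\ exists2 f', deriv_fun f f' & leading n' f' (n%:R * c)
  else f z0 = c.

Lemma leading_pred n f c : leading n.+1 f c -> leading n f 0.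
Proof.
elim: n f c => [f c [] //|n IH] f c [f0 [f' ff' Hf']]; split => //.
by exists f' => //; rewrite mulr0; exact: IH Hf'.
Qed.

Lemma leadingD n f g c d : leading n f c -> leading n g d ->
  leading n (fun z => f z + g z) (c + d).
Proof.
elim: n f g c d => [f g c d /= -> -> //|n IH] f g c d [f0 [f' h1 h2]] [g0 [g' h3 h4]].
split; first by rewrite f0 g0 addr0.
by eexists; [exact: deriv_funD h1 h3|rewrite mulrDr; exact: IH].
Qed.

Lemma leading0 n : leading n (fun=> 0) 0.
Proof.
elim: n => [//|n IH]; split => //; exists (fun=> 0); first exact: deriv_fun_cst.
by rewrite mulr0.
Qed.

(** Induction on the total order: the product rule lowers the order of one factor at a time, and the
    two coefficients add up to [(m + l) c d]. *)
Lemma leadingM m l f g c d : smooth f -> smooth g -> leading m f c -> leading l g d ->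
  leading (m + l) (fun z => f z * g z) (c * d).
Proof.
move: {2}(m + l)%N (erefl (m + l)%N) => s.
elim: s m l f g c d => [|s IH] m l f g c d ms Sf Sg Hf Hg.
  move: ms Hf Hg => /eqP; rewrite addn_eq0 => /andP[/eqP -> /eqP ->].
  by rewrite addn0 /= => -> ->.
have [f' ff' Sf'] := smooth_deriv Sf; have [g' gg' Sg'] := smooth_deriv Sg.
have H1 : leading s (fun z => f' z * g z) (m%:R * c * d).
  (* For [m = 0] the order [s + 1] of [g] is weakened to [s] with coefficient 0, in agreement with
     the factor [m%:R]. *)
  case: m ms Hf => [|m] ms Hf.
    rewrite add0n in ms; rewrite !mul0r; rewrite ms in Hg.
    have := IH 0%N s f' g (f' z0) 0 (add0n _) Sf' Sg erefl (leading_pred Hg).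
    by rewrite mulr0 add0n.
  have [_ [f'' ff'' Hf'']] := Hf; rewrite -(deriv_fun_unique ff' ff'') in Hf''.
  by have [ms'] := ms; rewrite -ms'; apply: IH.
have H2 : leading s (fun z => f z * g' z) (c * (l%:R * d)).
  case: l ms Hg {H1} => [|l] ms Hg.
    rewrite addn0 in ms; rewrite mul0r mulr0; rewrite ms in Hf.
    have := IH s 0%N f g' 0 (g' z0) (addn0 _) Sf Sg' (leading_pred Hf) erefl.
    by rewrite mul0r addn0.
  have [_ [g'' gg'' Hg'']] := Hg; rewrite -(deriv_fun_unique gg' gg'') in Hg''.
  by move: ms; rewrite addnS => -[ms]; rewrite -ms; apply: IH.
rewrite ms; split; last first.
  eexists; first exact: deriv_funM ff' gg'.
  have -> : s.+1%:R * (c * d) = m%:R * c * d + c * (l%:R * d).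
    by rewrite -ms natrD; ring.
  exact: leadingD.
case: m ms Hf {H1 H2} => [|m] ms Hf; last by case: Hf => ->; rewrite mul0r.
by rewrite add0n in ms; rewrite ms in Hg; case: Hg => ->; rewrite mulr0.
Qed.

Lemma leading_prod n (F : 'I_n -> K -> K) (w : 'I_n -> nat) (c : 'I_n -> K) :
  (forall i, smooth (F i)) -> (forall i, leading (w i) (F i) (c i)) ->
  smooth (fun z => \prod_i F i z) /\
  leading (\sum_i w i) (fun z => \prod_i F i z) (\prod_i c i).
Proof.
elim: n F w c => [|n IH] F w c SF HF.
  under eq_fun do rewrite big_ord0; rewrite !big_ord0; split => //; exact: smooth_cst.
under eq_fun do rewrite big_ord_recl; rewrite !big_ord_recl.
have [h1 h2] := IH _ _ _ (fun i => SF (lift ord0 i)) (fun i => HF (lift ord0 i)).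
by split; [exact: smoothM|exact: leadingM].
Qed.

Lemma leading_sum n (I : Type) (r : seq I) (F : I -> K -> K) (c : I -> K) :
  (forall i, leading n (F i) (c i)) ->
  leading n (fun z => \sum_(i <- r) F i z) (\sum_(i <- r) c i).
Proof.
move=> H; elim: r => [|i r IH].
  by under eq_fun do rewrite big_nil; rewrite big_nil; exact: leading0.
by under eq_fun do rewrite big_cons; rewrite big_cons; exact: leadingD.
Qed.

(** The weights depend on the column only, so all terms of the Leibniz expansion have the same order
    and their coefficients assemble into [\det L]. *)
Lemma leading_det n (M : K -> 'M[K]_n) (w : 'I_n -> nat) (L : 'M[K]_n) :
  (forall i j, smooth (fun z => M z i j)) ->
  (forall i j, leading (w j) (fun z => M z i j) (L i j)) ->
  leading (\sum_j w j) (fun z => \det (M z)) (\det L).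
Proof.
move=> SM HM; apply: leading_sum => s.
have [h1 h2] := leading_prod (fun i => SM i (s i)) (fun i => HM i (s i)).
have -> : (\sum_j w j = 0 + \sum_i w (s i))%N.
  by rewrite add0n (reindex_inj (@perm_inj _ s)).
by apply: leadingM => //; exact: smooth_cst.
Qed.

Lemma leading_derive1n n f c : leading n f c ->
  (forall k, (k < n)%N -> @derive1n K K^o k f z0 = 0) /\
  @derive1n K K^o n f z0 = (n`!)%:R * c.
Proof.
elim: n f c => [|n IH] f c; first by move=> /= ->; rewrite mul1r.
move=> [f0 [f' ff' /IH [h1 h2]]].
have dE : @derive1 K K^o f = f'.
  by apply/funext => z; rewrite derive1E; case: (deriv_fun_is_derive z ff').
split; last by rewrite derive1Sn dE h2 factS natrM mulrCA mulrA.
by case=> [_|k kn]; [rewrite derive1n0|rewrite derive1Sn dE; exact: h1].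
Qed.

End OrderOfVanishing.

(** * Derivatives of all orders in the spectral parameter *)

Section ParameterSmooth.
Context {R : realType}.
Local Notation C := (R[i]).
Variables (a b : R).
Hypothesis ab : a <= b.

Lemma param_derive m (K0 K1 : R -> 'M[C]_m) (x : C -> R -> 'cV[C]_m) :
  param_sys a b K0 K1 x -> exists y : C -> R -> 'cV[C]_m,
  [/\ forall l, y l a = 0,
      forall l, ode a b (y l) (fun t => (K0 t + l *: K1 t) *m y l t + K1 t *m x l t) &
      forall t i, t \in `[a, b] -> deriv_fun (fun l : C => x l t i 0) (fun l => y l t i 0)].
Proof.
move=> sys; have /choice [y Hy] := param_derive_at ab sys.
exists y; split=> [l|l|t i tI l]; first by case: (Hy l).
  by case: (Hy l).
by case: (Hy l) => _ _; exact.
Qed.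

(* The pair formed by a solution and its derivative in [l] solves a system of the
   same form and twice the size, to which the induction hypothesis applies. *)
Lemma param_smooth m (K0 K1 : R -> 'M[C]_m) (x : C -> R -> 'cV[C]_m) t i :
  param_sys a b K0 K1 x -> t \in `[a, b] -> smooth (fun l : C => x l t i 0).
Proof.
move=> + tI N; elim: N m K0 K1 x i => [//|N IH] m K0 K1 x i sys.
have [y [ya yo yd]] := param_derive sys.
exists (fun l => y l t i 0); first exact: yd.
case: (sys) => [[k0 k00 H0] [k1 k10 H1] xo xa].
pose X l t := col_mx (x l t) (y l t).
have sys' : param_sys a b (fun t => block_mx (K0 t) 0 (K1 t) (K0 t))
                          (fun t => block_mx (K1 t) 0 0 (K1 t)) X.
  split.
  - exists (k0 + k1); first exact: addr_ge0.
    apply: aeI_mp H1 _; apply: aeI_imp H0 => s _ h0 h1 i' j'.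
    case: (split_ordP i') => p ->; case: (split_ordP j') => q ->.
    + by rewrite block_mxEul; apply: le_trans (h0 p q) _; rewrite lerDl.
    + by rewrite block_mxEur mxE Normc.normc0 addr_ge0.
    + by rewrite block_mxEdl; apply: le_trans (h1 p q) _; rewrite lerDr.
    + by rewrite block_mxEdr; apply: le_trans (h0 p q) _; rewrite lerDl.
  - exists k1 => //; apply: aeI_imp H1 => s _ h1 i' j'.
    case: (split_ordP i') => p ->; case: (split_ordP j') => q ->.
    + by rewrite block_mxEul.
    + by rewrite block_mxEur mxE Normc.normc0.
    + by rewrite block_mxEdl mxE Normc.normc0.
    + by rewrite block_mxEdr.
  - move=> l; apply: ode_eq (ode_col (xo l) (yo l)) _; apply: aeI_all => s _.
    rewrite scale_block_mx add_block_mx mul_block_col !scaler0 !addr0 mul0mx addr0.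
    by rewrite [_ + K1 s *m _]addrC.
  - by move=> l l'; rewrite /X !ya (xa l l').
by have := IH _ _ _ _ (rshift m i) sys'; rewrite /X; under eq_fun do rewrite col_mxEd.
Qed.

End ParameterSmooth.

(** * Conjugate transposes and self-adjoint boundary conditions *)

Section Adjoint.
Context {R : realType}.
Local Notation C := (R[i]).
Local Notation Re := complex.Re.
Local Notation Im := complex.Im.
Local Notation normc := (@Normc.normc R).

Lemma adjmxE m n (M : 'M[C]_(m, n)) i j : adjmx M i j = (M j i)^*.
Proof. by rewrite !mxE. Qed.

Lemma adjmxK m n (M : 'M[C]_(m, n)) : adjmx (adjmx M) = M.
Proof. by apply/matrixP => i j; rewrite !adjmxE conjCK. Qed.

Lemma adjmxM m n p (M : 'M[C]_(m, n)) (N : 'M[C]_(n, p)) :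
  adjmx (M *m N) = adjmx N *m adjmx M.
Proof. by rewrite /adjmx trmx_mul map_mxM. Qed.

Lemma adjmxD m n (M N : 'M[C]_(m, n)) : adjmx (M + N) = adjmx M + adjmx N.
Proof. by rewrite /adjmx linearD map_mxD. Qed.

Lemma adjmxN m n (M : 'M[C]_(m, n)) : adjmx (- M) = - adjmx M.
Proof. by rewrite /adjmx linearN map_mxN. Qed.

Lemma adjmxZ m n c (M : 'M[C]_(m, n)) : adjmx (c *: M) = c^* *: adjmx M.
Proof. by apply/matrixP => i j; rewrite adjmxE !mxE rmorphM. Qed.

Lemma adjmx_cmx d (M : 'M[R]_d) : M^T = M -> adjmx (cmx M) = cmx M.
Proof.
move=> sM; rewrite -[in RHS]sM; apply/matrixP => i j.
by rewrite adjmxE !mxE /=; apply/eqP; rewrite eq_complex cReJ cImJ /= oppr0 !eqxx.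
Qed.

Lemma adjmx_col m n p (M : 'M[C]_(m, p)) (N : 'M[C]_(n, p)) :
  adjmx (col_mx M N) = row_mx (adjmx M) (adjmx N).
Proof. by rewrite /adjmx tr_col_mx map_row_mx. Qed.

Lemma adjmx_row m n p (M : 'M[C]_(p, m)) (N : 'M[C]_(p, n)) :
  adjmx (row_mx M N) = col_mx (adjmx M) (adjmx N).
Proof. by rewrite /adjmx tr_row_mx map_col_mx. Qed.

Lemma rank_adjmx m n (M : 'M[C]_(m, n)) : \rank (adjmx M) = \rank M.
Proof. by rewrite /adjmx mxrank_map mxrank_tr. Qed.

Lemma derC_adjM d (u p : R -> 'cV[C]_d) t du dp :
  has_deriv_cv u t du -> has_deriv_cv p t dp ->
  derC (fun s => (adjmx (u s) *m p s) 0 0) t ((adjmx du *m p t + adjmx (u t) *m dp) 0 0).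
Proof.
move=> hu hp; under eq_fun do rewrite mxE; rewrite !mxE -big_split /=.
apply: derC_sum => i; under eq_fun do rewrite adjmxE; rewrite !adjmxE.
by apply: derCM; [apply: derCJ; exact: hu|exact: hp].
Qed.

Lemma lipC_adjM d a b (u p : R -> 'cV[C]_d) : a <= b ->
  (forall i, lipC a b (fun t => u t i 0)) -> (forall i, lipC a b (fun t => p t i 0)) ->
  lipC a b (fun s => (adjmx (u s) *m p s) 0 0).
Proof.
move=> ab hu hp; under eq_fun do rewrite mxE.
apply: lipC_sum => i; under eq_fun do rewrite adjmxE.
by apply: lipCM => //; exact: lipCJ.
Qed.

(* Both solution vectors lie in the range of [col_mx B^* (- A^* )], which by the
   rank condition is the whole kernel of [row_mx A B]. *)
Lemma bc_form0 d (A B : 'M[C]_(d + d)) (U1 U2 Y1 Y2 : 'cV[C]_(d + d)) : bc_ok A B ->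
  row_mx A B *m col_mx U1 U2 = 0 -> row_mx A B *m col_mx Y1 Y2 = 0 ->
  adjmx U1 *m Y2 = adjmx U2 *m Y1.
Proof.
move=> [rAB AB] HU HY.
(* The range is transposed, because rank and inclusion refer to row spaces. *)
pose S := row_mx (adjmx B)^T (- (adjmx A)^T).
have rS : \rank S = (d + d)%N.
  apply: etrans _ rAB; rewrite -[RHS]rank_adjmx adjmx_row.
  have -> : S = (col_mx (adjmx B) (- adjmx A))^T by rewrite tr_col_mx linearN.
  rewrite mxrank_tr.
  (* The symplectic matrix: invertible, it carries the adjoint of [row_mx A B] to [S^T] and so
     preserves the rank. *)
  pose J : 'M[C]_(d + d + (d + d)) := block_mx 0 1%:M (- 1%:M) 0.
  have -> : col_mx (adjmx B) (- adjmx A) = J *m col_mx (adjmx A) (adjmx B).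
    by rewrite mul_block_col !mul0mx mul1mx add0r addr0 mulNmx mul1mx.
  rewrite eqmxMfull // row_full_unit.
  have /mulmx1_unit [] // : J *m (- J) = 1%:M.
  rewrite mulmxN mulmx_block !mul0mx !mulmx0 !mul1mx !mulmx1 !add0r !addr0.
  by rewrite opp_block_mx !oppr0 opprK -scalar_mx_block.
have ker (U : 'cV[C]_(d + d + (d + d))) : row_mx A B *m U = 0 ->
    exists xi : 'cV[C]_(d + d), U = col_mx (adjmx B *m xi) (- (adjmx A *m xi)).
  move=> HU'.
  have sub : (S <= kermx (row_mx A B)^T)%MS.
    apply/sub_kermxP; rewrite tr_row_mx /S mul_row_col -!trmx_mul mulNmx -trmx_mul AB.
    by rewrite subrr.
  (* The inclusion is [A B^* = B A^*], and both spaces have dimension [2d = 4d - 2d]. *)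
  have eqr : (S == kermx (row_mx A B)^T)%MS.
    rewrite -(geq_leqif (mxrank_leqif_eq sub)) mxrank_ker mxrank_tr rAB rS.
    by rewrite addnK.
  have : (U^T <= S)%MS.
    by rewrite (eqmxP eqr); apply/sub_kermxP; rewrite -trmx_mul HU' trmx0.
  move=> /submxP [xi Hxi]; exists xi^T.
  by rewrite -[U]trmxK Hxi /S mul_mx_row tr_row_mx !trmx_mul linearN /= !trmxK mulNmx.
have [xi /eq_col_mx [-> ->]] := ker _ HU; have [et /eq_col_mx [-> ->]] := ker _ HY.
(* The two sides are [- xi^* B A^* et] and [- xi^* A B^* et]. *)
rewrite adjmxN !adjmxM !adjmxK mulNmx mulmxN -!mulmxA; congr (- _).
by rewrite !mulmxA -[_ *m B *m _]mulmxA -AB !mulmxA.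
Qed.

End Adjoint.

(** * Uniformly positive matrices and bounds on the coefficients *)

Section Coercive.
Context {R : realType} {d : nat}.
Local Notation C := (R[i]).
Local Notation Re := (@complex.Re R).
Local Notation Im := (@complex.Im R).
Local Notation normc := (@Normc.normc R).

Definition coercive (mu : R) (M : 'M[R]_d) :=
  forall v : 'cV[R]_d, mu * (v^T *m v) 0 0 <= (v^T *m M *m v) 0 0.

Lemma dotmxE (v : 'cV[R]_d) : (v^T *m v) 0 0 = \sum_i v i 0 ^+ 2.
Proof. by rewrite mxE; apply: eq_bigr => i _; rewrite mxE expr2. Qed.

Lemma dotmx_eq0 (v : 'cV[R]_d) : (v^T *m v) 0 0 <= 0 -> v = 0.
Proof.
rewrite dotmxE => h; apply/matrixP => i j; rewrite ord1 mxE; apply/eqP.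
have := h; rewrite (bigD1 i) //= => hi.
have s0 : 0 <= \sum_(k | k != i) v k 0 ^+ 2 by apply: sumr_ge0 => k _; exact: sqr_ge0.
by rewrite -sqrf_eq0 eq_le sqr_ge0 andbT; lra.
Qed.

Lemma coercive_unit mu M : 0 < mu -> coercive mu M -> M \in unitmx.
Proof.
move=> mu0 H; rewrite -row_free_unit; apply: inj_row_free => v vM.
have := H v^T; rewrite trmxK vM mul0mx [X in _ <= X]mxE pmulr_rle0 // => h.
by apply: trmx_inj; rewrite trmx0; apply: dotmx_eq0; rewrite trmxK.
Qed.

(** Testing on the column [y = M^-1 e_j] gives [mu |y|^2 <= (M^-1)_jj]. Its entry [j] bounds the
    diagonal by [1 / mu], and then every entry of the column. *)
Lemma coercive_inv_bound mu M i j : 0 < mu -> coercive mu M ->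
  `|invmx M i j| <= mu^-1.
Proof.
move=> mu0 H; have uM := coercive_unit mu0 H.
pose y := col j (invmx M).
have yE k : y k 0 = invmx M k j by rewrite mxE.
have := H y; rewrite -mulmxA.
have -> : M *m y = col j 1%:M by rewrite /y !colE mulmxA mulmxV.
have -> : (y^T *m col j 1%:M) 0 0 = invmx M j j.
  rewrite mxE (bigD1 j) //= big1 ?addr0; last first.
    by move=> k kj; rewrite !mxE (negPf kj) mulr0.
  by rewrite !mxE eqxx mulr1.
rewrite dotmxE => h.
have part k : mu * invmx M k j ^+ 2 <= invmx M j j.
  apply: le_trans h; rewrite ler_pM2l // (bigD1 k) //= yE lerDl.
  by apply: sumr_ge0 => l _; exact: sqr_ge0.
have hj := part j; set z := invmx M j j in hj part.
have zp : z <= mu^-1.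
  have [z0|z0] := leP z 0; first by apply: le_trans z0 _; rewrite invr_ge0 ltW.
  by rewrite -[mu^-1]mul1r ler_pdivlMr // mulrC -(ler_pM2r z0) mul1r -mulrA -expr2.
rewrite -(@ler_pXn2r _ 2) ?nnegrE ?invr_ge0 ?(ltW mu0) // real_normK ?num_real //.
rewrite -(ler_pM2l mu0) [mu^-1 ^+ 2]expr2 [mu * (_ / _)]mulrA divff ?gt_eqF // mul1r.
exact: le_trans (part i) zp.
Qed.

(** A real matrix leaves no cross terms in the real part; real coercivity thereby passes to complex
    vectors. *)
Lemma Re_form (M : 'M[R]_d) (v : 'cV[C]_d) :
  Re ((adjmx v *m cmx M *m v) 0 0) =
  ((map_mx Re v)^T *m M *m map_mx Re v) 0 0 + ((map_mx Im v)^T *m M *m map_mx Im v) 0 0.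
Proof.
rewrite -!mulmxA !mxE cRe_sum -big_split; apply: eq_bigr => i _ /=.
rewrite adjmxE !mxE !mulr_sumr cRe_sum -big_split; apply: eq_bigr => j _ /=.
by rewrite !mxE !cReM !cImM cReJ cImJ /=; ring.
Qed.

Lemma coercive_form_ge0 mu M (v : 'cV[C]_d) : 0 < mu -> coercive mu M ->
  0 <= Re ((adjmx v *m cmx M *m v) 0 0).
Proof.
move=> mu0 H; rewrite Re_form; apply: addr_ge0; apply: le_trans (H _).
  by rewrite mulr_ge0 ?(ltW mu0) // dotmxE sumr_ge0 // => i _; exact: sqr_ge0.
by rewrite mulr_ge0 ?(ltW mu0) // dotmxE sumr_ge0 // => i _; exact: sqr_ge0.
Qed.

Lemma coercive_form_eq0 mu M (v : 'cV[C]_d) : 0 < mu -> coercive mu M ->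
  Re ((adjmx v *m cmx M *m v) 0 0) = 0 -> v = 0.
Proof.
move=> mu0 H; rewrite Re_form => h.
have sq0 (w : 'cV[R]_d) : 0 <= (w^T *m w) 0 0.
  by rewrite dotmxE sumr_ge0 // => i _; exact: sqr_ge0.
have h1 := H (map_mx Re v); have h2 := H (map_mx Im v).
have p1 := mulr_ge0 (ltW mu0) (sq0 (map_mx Re v)).
have p2 := mulr_ge0 (ltW mu0) (sq0 (map_mx Im v)).
have e1 : map_mx Re v = 0 by apply: dotmx_eq0; rewrite -(pmulr_rle0 _ mu0); lra.
have e2 : map_mx Im v = 0 by apply: dotmx_eq0; rewrite -(pmulr_rle0 _ mu0); lra.
apply/matrixP => i j; rewrite ord1; move/matrixP: e1 => /(_ i 0);
  move/matrixP: e2 => /(_ i 0).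
by rewrite !mxE => ei er; apply/eqP; rewrite eq_complex er ei !eqxx.
Qed.

Lemma cmx_unit (M : 'M[R]_d) : (cmx M \in unitmx) = (M \in unitmx).
Proof. exact: (map_unitmx (real_complex R)). Qed.

Lemma cmx_inv (M : 'M[R]_d) : cmx (invmx M) = invmx (cmx M).
Proof. exact: (map_invmx (real_complex R)). Qed.

Lemma normc_cmx (M : 'M[R]_d) i j : normc (cmx M i j) = `|M i j|.
Proof. by rewrite mxE /= expr0n addr0 sqrtr_sqr. Qed.

Variables (a b : R) (P Q W : R -> 'M[R]_d).

(** The pointwise facts on the coefficients, under one bound and one almost-everywhere statement. *)
Record coefs (kap mu : R) (t : R) : Prop := Coefs {
  coefP : P t \in unitmx;
  coefPi : forall i j, normc (invmx (cmx (P t)) i j) <= kap;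
  coefQ : forall i j, normc (cmx (Q t) i j) <= kap;
  coefW : forall i j, normc (cmx (W t) i j) <= kap;
  coefPs : adjmx (cmx (P t)) = cmx (P t);
  coefQs : adjmx (cmx (Q t)) = cmx (Q t);
  coefWs : adjmx (cmx (W t)) = cmx (W t);
  coefWc : coercive mu (W t) }.

Lemma in_Omega_coefs : in_Omega a b P Q W ->
  exists kap mu, [/\ 0 <= kap, 0 < mu & aeI a b (coefs kap mu)].
Proof.
move=> [[[_ [kP HP]] [[_ [kQ HQ]] [_ [kW HW]]]] [sP [sQ sW]] [m1 m10 H1] [m2 m20 H2]].
exists (m1^-1 + `|kQ| + `|kW|), m2; split => //.
  by rewrite !addr_ge0 // invr_ge0 ltW.
have i1 : 0 <= m1^-1 by rewrite invr_ge0 ltW.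
apply: aeI_mp HQ _; apply: aeI_mp HW _; apply: aeI_mp sP _; apply: aeI_mp sQ _.
apply: aeI_mp sW _; apply: aeI_mp H1 _; apply: aeI_imp H2 => t _ h2 h1 sw sq sp hw hq.
split => //; try exact: adjmx_cmx.
- exact: coercive_unit m10 h1.
- move=> i j; rewrite -cmx_inv normc_cmx; apply: le_trans (coercive_inv_bound i j m10 h1) _.
  by rewrite -addrA lerDl addr_ge0.
- move=> i j; rewrite normc_cmx; apply: le_trans (hq i j) _.
  by apply: le_trans (ler_norm _) _; have := normr_ge0 kW; lra.
- move=> i j; rewrite normc_cmx; apply: le_trans (hw i j) _.
  by apply: le_trans (ler_norm _) _; have := normr_ge0 kQ; lra.
Qed.

End Coercive.

(** * The first-order system, the Lagrange identity and its consequences *)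

Section Lagrange.
Context {R : realType} {d : nat}.
Local Notation C := (R[i]).
Local Notation Re := (@complex.Re R).
Local Notation Im := (@complex.Im R).
Local Notation normc := (@Normc.normc R).
Variables (a b : R) (P Q W : R -> 'M[R]_d).
Hypothesis ab : a < b.
Hypothesis Om : in_Omega a b P Q W.
Let ab' : a <= b := ltW ab.

Lemma cvBE m (X Y : 'cV[C]_m) i : (X - Y) i 0 = X i 0 - Y i 0.
Proof. by rewrite !mxE. Qed.

Lemma cvDE m (X Y : 'cV[C]_m) i : (X + Y) i 0 = X i 0 + Y i 0.
Proof. by rewrite mxE. Qed.

Lemma adjmx_inv m (M : 'M[C]_m) : M \in unitmx -> adjmx M = M -> adjmx (invmx M) = invmx M.
Proof.
move=> uM sM; have a1 : adjmx (1%:M : 'M[C]_m) = 1%:M.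
  by apply/matrixP => i j; rewrite adjmxE !mxE eq_sym rmorph_nat.
have h : adjmx (invmx M) *m M = 1%:M by rewrite -[in X in _ *m X]sM -adjmxM mulmxV.
by rewrite -[LHS](mulmxK uM) h mul1mx.
Qed.

Lemma ac_cv_bounded (y : R -> 'cV[C]_d) : ac_cv a b y ->
  exists2 M : R, 0 <= M & forall t i, t \in `[a, b] -> normc (y t i 0) <= M.
Proof.
move=> ac.
have /choice [M HM] : forall i, exists M : R, 0 <= M /\
    forall t, t \in `[a, b] -> normc (y t i 0) <= M.
  move=> i; have [/(abs_cont_bounded ab') [M M0 HM] /(abs_cont_bounded ab') [N N0 HN]] :=
    ac i.
  exists (M + N); split; first exact: addr_ge0.
  by move=> t tI; apply: le_trans (normc_le _) _; apply: lerD; [exact: HM|exact: HN].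
exists (\sum_i M i); first by apply: sumr_ge0 => i _; case: (HM i).
move=> t i tI; apply: (@le_trans _ _ (M i)); first by case: (HM i) => _; exact.
by rewrite (bigD1 i) //= lerDl; apply: sumr_ge0 => j _; case: (HM j).
Qed.

Lemma ac_cv_ode (y g : R -> 'cV[C]_d) (L : R) : 0 <= L -> ac_cv a b y ->
  aeI a b (fun t => has_deriv_cv y t (g t) /\ forall i, normc (g t i 0) <= L) ->
  ode a b y g.
Proof.
move=> L0 ac yd; split; last by apply: aeI_imp yd => t _ [].
move=> i; have [h1 h2] := ac i; split; exists L => //.
  apply: abs_cont_lip => //; apply: aeI_imp yd => t _ [yt gt].
  by exists (Re (g t i 0)); [case: (yt i)|exact: le_trans (Re_le_normc _) (gt i)].
apply: abs_cont_lip => //; apply: aeI_imp yd => t _ [yt gt].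
by exists (Im (g t i 0)); [case: (yt i)|exact: le_trans (Im_le_normc _) (gt i)].
Qed.

Lemma ode_ac_cv (y g : R -> 'cV[C]_d) : ode a b y g -> ac_cv a b y.
Proof. by move=> [yl _] i; case: (yl i) => h1 h2; split; exact: lip_abs_cont. Qed.

(* [- (P y')' + Q y = W f] in first-order form, with [p = P y'] *)
Definition slpair (f y p : R -> 'cV[C]_d) :=
  ode a b y (fun t => invmx (cmx (P t)) *m p t) /\
  ode a b p (fun t => cmx (Q t) *m y t - cmx (W t) *m f t).

Lemma normc_mulmx_const (M : 'M[C]_d) (v : 'cV[C]_d) (k L : R) i : 0 <= k ->
  (forall i j, normc (M i j) <= k) -> (forall i, normc (v i 0) <= L) ->
  normc ((M *m v) i 0) <= k * (d%:R * L).
Proof.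
move=> k0 Mk vL; apply: le_trans (normc_mulmx_le _ _ Mk) _; rewrite ler_wpM2l //.
have -> : d%:R * L = \sum_(j < d) L by rewrite sumr_const card_ord mulr_natl.
by apply: ler_sum => j _; exact: vL.
Qed.

(** Absolutely continuous [y] and [p] are bounded, so [y' = P^-1 p] and [p' = Q y - W f] are bounded
    almost everywhere and both functions are Lipschitz. Solutions from [sl_sol] and from [SLT] enter
    the Lipschitz setting here. *)
Lemma ac_slpair (f y p : R -> 'cV[C]_d) (F : R) :
  ac_cv a b y -> ac_cv a b p -> 0 <= F ->
  aeI a b (fun t => forall i, normc (f t i 0) <= F) ->
  aeI a b (fun t => exists2 dy, has_deriv_cv y t dy & p t = cmx (P t) *m dy) ->
  aeI a b (fun t => exists2 dp, has_deriv_cv p t dp &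
                 - dp + cmx (Q t) *m y t = cmx (W t) *m f t) ->
  slpair f y p.
Proof.
move=> yac pac F0 fF dY dP.
have [kap [mu [k0 mu0 co]]] := in_Omega_coefs Om.
have [Y Y0 HY] := ac_cv_bounded yac; have [N N0 HN] := ac_cv_bounded pac.
split.
  apply: (@ac_cv_ode _ _ (kap * (d%:R * N))) => //; first by rewrite !mulr_ge0.
  apply: aeI_mp co _; apply: aeI_imp dY => t tI [dy yd pE] co.
  have -> : invmx (cmx (P t)) *m p t = dy by rewrite pE mulKmx // cmx_unit (coefP co).
  split => // i; have -> : dy = invmx (cmx (P t)) *m p t.
    by rewrite pE mulKmx // cmx_unit (coefP co).
  by apply: normc_mulmx_const => //; [exact: coefPi co|move=> j; exact: HN].
apply: (@ac_cv_ode _ _ (kap * (d%:R * Y) + kap * (d%:R * F))) => //.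
  by rewrite addr_ge0 ?mulr_ge0.
apply: aeI_mp co _; apply: aeI_mp fF _; apply: aeI_imp dP => t tI [dp pd eq] fF co.
have -> : cmx (Q t) *m y t - cmx (W t) *m f t = dp.
  by rewrite -eq opprD opprK addrC -addrA addNr addr0.
split => // i; have -> : dp = cmx (Q t) *m y t - cmx (W t) *m f t.
  by rewrite -eq opprD opprK addrC -addrA addNr addr0.
rewrite cvBE; apply: le_trans (normcB _ _) _; apply: lerD.
  by apply: normc_mulmx_const => //; [exact: coefQ co|move=> j; exact: HY].
by apply: normc_mulmx_const => //; exact: coefW co.
Qed.

Lemma slpair_eq (f f' y p : R -> 'cV[C]_d) : aeI a b (fun t => f t = f' t) ->
  slpair f y p -> slpair f' y p.
Proof.
move=> ff [h1 h2]; split => //; apply: ode_eq h2 _.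
by apply: aeI_imp ff => t _ ->.
Qed.

Lemma eq_slpair (f f' y y' p p' : R -> 'cV[C]_d) : slpair f y p ->
  f =1 f' -> y =1 y' -> p =1 p' -> slpair f' y' p'.
Proof. by move=> h /funext <- /funext <- /funext <-. Qed.

Lemma slpairD (f g y z p q : R -> 'cV[C]_d) : slpair f y p -> slpair g z q ->
  slpair (fun t => f t + g t) (fun t => y t + z t) (fun t => p t + q t).
Proof.
move=> [h1 h2] [h3 h4]; split.
  by apply: ode_eq (odeD h1 h3) _; apply: aeI_all => t _; rewrite mulmxDr.
apply: ode_eq (odeD h2 h4) _; apply: aeI_all => t _.
by rewrite !mulmxDr opprD addrACA.
Qed.

Lemma slpairZ c (f y p : R -> 'cV[C]_d) : slpair f y p ->
  slpair (fun t => c *: f t) (fun t => c *: y t) (fun t => c *: p t).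
Proof.
move=> [h1 h2]; split.
  by apply: ode_eq (odeZ c ab' h1) _; apply: aeI_all => t _; rewrite -scalemxAr.
apply: ode_eq (odeZ c ab' h2) _; apply: aeI_all => t _.
by rewrite -!scalemxAr scalerBr.
Qed.

(** Zeros of [f] occur in every interval of positive length, hence arbitrarily near each [t], end
    points included. *)
Lemma lipC_ae0 (f : R -> C) : lipC a b f -> aeI a b (fun t => f t = 0) ->
  forall t, t \in `[a, b] -> f t = 0.
Proof.
have real (g : R -> R) : lip a b g -> aeI a b (fun t => g t = 0) ->
    forall t, t \in `[a, b] -> g t = 0.
  move=> [L L0 HL] g0 t tI; apply/eqP; rewrite -normr_eq0 eq_le normr_ge0 andbT.
  apply/ler_addgt0Pr => e e0; rewrite add0r.
  pose del := e / (L + 1); have del0 : 0 < del by rewrite divr_gt0 //; lra.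
  move: (tI); rewrite in_itv /= => /andP[at' tb].
  have [s] : exists2 s, s \in `[Num.max a (t - del), Num.min b (t + del)] & g s = 0.
    apply: aeI_ex; first by rewrite gt_max !lt_min ab /=; lra.
    by apply: aeI_sub g0; rewrite ?le_max ?ge_min lexx.
  rewrite in_itv /= ge_max le_min => /andP[/andP[s1 s2] /andP[s3 s4]] gs.
  have sI : s \in `[a, b] by rewrite in_itv /= s1 s3.
  have := HL t s tI sI; rewrite gs subr0 => h; apply: le_trans h _.
  have st : `|t - s| <= del by rewrite ler_norml; lra.
  apply: le_trans (ler_wpM2l L0 st) _.
  rewrite /del mulrA ler_pdivrMr; last lra.
  by rewrite mulrC ler_wpM2l //; lra.
move=> [l1 l2] f0 t tI; apply/eqP; rewrite eq_complex.
have -> : Re (f t) = 0 by apply: (real (fun s => Re (f s))) => //;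
  apply: aeI_imp f0 => s _ ->.
have -> : Im (f t) = 0 by apply: (real (fun s => Im (f s))) => //;
  apply: aeI_imp f0 => s _ ->.
by rewrite !eqxx.
Qed.

Lemma ode_ae0 (x g : R -> 'cV[C]_d) : ode a b x g -> aeI a b (fun t => x t = 0) ->
  forall t, t \in `[a, b] -> x t = 0.
Proof.
move=> [xl _] x0 t tI; apply/matrixP => i j; rewrite ord1 mxE.
by apply: (lipC_ae0 (xl i)) => //; apply: aeI_imp x0 => s _ ->; rewrite mxE.
Qed.

Lemma is_derive_const_on (f : R -> R) (c v t : R) : t \in `]a, b[ ->
  (forall s, s \in `[a, b] -> f s = c) -> is_derive t 1 f v -> v = 0.
Proof.
rewrite in_itv /= => /andP[ta tb] fc /is_derive_lin_approx fd.
apply/eqP; rewrite -normr_eq0 eq_le normr_ge0 andbT; apply/ler_addgt0Pr => e e0.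
rewrite add0r; have [del del0 H] := fd e e0.
pose h := Num.min (del / 2) (b - t).
have h0 : 0 < h by rewrite lt_min; apply/andP; split; lra.
have hd : h <= del / 2 by rewrite ge_min lexx.
have hb : h <= b - t by rewrite ge_min lexx orbT.
have := H (t + h); rewrite [t + h - t]addrC addKr gtr0_norm // => /(_ _).
rewrite !fc ?in_itv /=; try (apply/andP; split; lra).
rewrite subrr sub0r normrN normrM (gtr0_norm h0) ler_pM2r //; apply; lra.
Qed.

Lemma derive_nonpos_periodic (f g : R -> R) : lip a b f -> f a = f b ->
  aeI a b (fun t => is_derive t (1 : R) f (- g t) /\ 0 <= g t) ->
  aeI a b (fun t => g t = 0).
Proof.
move=> fl fab fg.
have fd : aeI a b (fun t => exists2 v : R, is_derive t (1 : R) f v & v <= 0).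
  by apply: aeI_imp fg => t _ [h1 h2]; exists (- g t) => //; lra.
have mono := lip_nonincreasing fl fd.
have fc s : s \in `[a, b] -> f s = f a.
  rewrite in_itv /= => /andP[s1 s2]; apply/eqP; rewrite eq_le; apply/andP; split.
    exact: mono.
  by rewrite fab; exact: mono.
apply: aeI_mp fg _; apply: aeI_imp (aeI_oo a b) => t _ tI [h _].
by have /eqP := is_derive_const_on tI fc h; rewrite oppr_eq0 => /eqP.
Qed.

(** Equality in [L2W] sees only [y], while the initial data also involve [p]. As [y] vanishes
    identically, so does [y' = P^-1 p] almost everywhere. *)
Lemma slpair_p0 (f y p : R -> 'cV[C]_d) : slpair f y p ->
  aeI a b (fun t => y t = 0) -> forall t, t \in `[a, b] -> p t = 0.
Proof.
move=> [h1 h2] y0; have [kap [mu [k0 mu0 co]]] := in_Omega_coefs Om.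
have yz := ode_ae0 h1 y0.
apply: ode_ae0 h2 _; case: h1 => _ yd.
apply: aeI_mp co _; apply: aeI_mp yd _; apply: aeI_imp (aeI_oo a b) => t tI toI yt co.
have dy0 : invmx (cmx (P t)) *m p t = 0.
  apply/matrixP => i j; rewrite ord1 [RHS]mxE; have [d1 d2] := yt i.
  apply/eqP; rewrite eq_complex; apply/andP; split; apply/eqP.
    by apply: (is_derive_const_on toI _ d1) => s sI; rewrite (yz s sI) mxE.
  by apply: (is_derive_const_on toI _ d2) => s sI; rewrite (yz s sI) mxE.
by rewrite -[p t](mulKVmx (_ : cmx (P t) \in unitmx)) ?dy0 ?mulmx0 // cmx_unit (coefP co).
Qed.

Variables (A B : 'M[C]_(d + d)).
Hypothesis bc : bc_ok A B.

(** [P] and [Q] are symmetric, so their terms cancel in the derivative of [F]. The sign of [- y a]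
    in [Yab] turns the symplectic relation [bc_form0] into equality of the end values. *)
Lemma lagrange (fu u pu fy y py : R -> 'cV[C]_d) :
  slpair fu u pu -> slpair fy y py ->
  row_mx A B *m Yab a b u pu = 0 -> row_mx A B *m Yab a b y py = 0 ->
  let F t := (adjmx (u t) *m py t) 0 0 - (adjmx (pu t) *m y t) 0 0 in
  [/\ lipC a b F, F a = F b &
      aeI a b (fun t => derC F t ((adjmx (fu t) *m cmx (W t) *m y t) 0 0 -
                                   (adjmx (u t) *m cmx (W t) *m fy t) 0 0))].
Proof.
move=> [ul pul] [yl pyl] bu by_ F.
have [kap [mu [k0 mu0 co]]] := in_Omega_coefs Om.
split.
- apply: lipCD; first by apply: lipC_adjM => //; [case: ul|case: pyl].
  by apply: lipCN; apply: lipC_adjM => //; [case: pul|case: yl].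
- have := bc_form0 bc bu by_; rewrite !adjmx_col !mul_row_col adjmxN => /matrixP /(_ 0 0).
  have cvNE (X : 'M[C]_1) : (- X) 0 0 = - X 0 0 by rewrite mxE.
  rewrite mulNmx mulmxN !cvDE !cvNE => h; rewrite /F.
  move: h; set x1 := (_ *m py a) 0 0; set x2 := (_ *m py b) 0 0.
  set x3 := (_ *m y a) 0 0; set x4 := (_ *m y b) 0 0 => h.
  have -> : x2 = x1 + (- x1 + x2) by ring.
  by rewrite h; ring.
case: ul => _ ud; case: pul => _ pud; case: yl => _ yd; case: pyl => _ pyd.
apply: aeI_mp co _; apply: aeI_mp ud _; apply: aeI_mp pud _; apply: aeI_mp yd _.
apply: aeI_imp pyd => t _ pyt yt put ut co.
have := derCD (derC_adjM ut pyt) (derCN (derC_adjM put yt)).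
congr (derC _ t _).
have uP : cmx (P t) \in unitmx by rewrite cmx_unit (coefP co).
rewrite adjmxM (adjmx_inv uP (coefPs co)) adjmxD adjmxN !adjmxM (coefQs co) (coefWs co).
by rewrite mulmxBl mulmxBr !mulmxA !(cvBE, cvDE); ring.
Qed.

Lemma eigenpair_real (l : C) (u pu : R -> 'cV[C]_d) :
  slpair (fun t => l *: u t) u pu -> row_mx A B *m Yab a b u pu = 0 ->
  Im l = 0 \/ aeI a b (fun t => u t = 0).
Proof.
move=> hu bu; have [kap [mu [k0 mu0 co]]] := in_Omega_coefs Om.
have [Im0|Imn] := eqVneq (Im l) 0; [by left|right].
have /= [] := lagrange hu hu bu bu; set F := fun t => _ - _ => Fl Fab Fd.
(* The derivative of [Im F] is [- 2 * Im l] times the [W]-form; one more factor [Im l] fixes the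
   sign. *)
pose g t := 2 * Im l ^+ 2 * Re ((adjmx (u t) *m cmx (W t) *m u t) 0 0).
have : aeI a b (fun t => g t = 0).
  apply: (@derive_nonpos_periodic (fun t => Im l * Im (F t))).
  - by apply: lipM => //; [exact: lip_cst|case: Fl].
  - by rewrite (Fab : F a = F b).
  apply: aeI_mp co _; apply: aeI_imp Fd => t _ [_ Fd] co; split; last first.
    apply: mulr_ge0; first by rewrite mulr_ge0 ?sqr_ge0.
    exact: (coercive_form_ge0 _ mu0 (coefWc co)).
  have /is_derive_eq := is_deriveM' (is_derive_cst (Im l) t (1 : R)) Fd; apply.
  rewrite mul0r add0r adjmxZ -!scalemxAl -!scalemxAr /g.
  set q := _ *m u t; rewrite !mxE cImD cImN !cImM cReJ cImJ; ring.
move=> H; apply: aeI_mp co _; apply: aeI_imp H => t _ gt co.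
apply: (coercive_form_eq0 mu0 (coefWc co)).
by move/eqP: gt; rewrite /g mulf_eq0 mulf_eq0 sqrf_eq0 (negPf Imn) pnatr_eq0 => /eqP.
Qed.

Lemma no_jordan_chain (l : C) (u pu y py : R -> 'cV[C]_d) : Im l = 0 ->
  slpair (fun t => l *: u t) u pu -> row_mx A B *m Yab a b u pu = 0 ->
  slpair (fun t => l *: y t + u t) y py -> row_mx A B *m Yab a b y py = 0 ->
  aeI a b (fun t => u t = 0).
Proof.
move=> Iml hu bu hy by_; have [kap [mu [k0 mu0 co]]] := in_Omega_coefs Om.
have lJ : l^* = l by apply/eqP; rewrite eq_complex cReJ cImJ Iml oppr0 !eqxx.
have /= [] := lagrange hu hy bu by_; set F := fun t => _ - _ => Fl Fab Fd.
have : aeI a b (fun t => Re ((adjmx (u t) *m cmx (W t) *m u t) 0 0) = 0).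
  apply: (@derive_nonpos_periodic (fun t => Re (F t))); first by case: Fl.
    by rewrite (Fab : F a = F b).
  apply: aeI_mp co _; apply: aeI_imp Fd => t _ [Fd _] co; split; last first.
    exact: (coercive_form_ge0 _ mu0 (coefWc co)).
  move: Fd => /is_derive_eq; apply.
  rewrite adjmxZ lJ mulmxDr -!scalemxAl -!scalemxAr cvDE opprD addrA subrr sub0r.
  by rewrite cReN.
move=> H; apply: aeI_mp co _; apply: aeI_imp H => t _ gt co.
exact: (coercive_form_eq0 mu0 (coefWc co)).
Qed.

Definition slK0 t : 'M[C]_(d + d) :=
  block_mx 0 (invmx (cmx (P t))) (cmx (Q t)) 0.
Definition slK1 t : 'M[C]_(d + d) := block_mx 0 0 (- cmx (W t)) 0.

Lemma slK_bounded : bounded_mx a b slK0 /\ bounded_mx a b slK1.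
Proof.
have [kap [mu [k0 mu0 co]]] := in_Omega_coefs Om.
split; exists kap => //; apply: aeI_imp co => t _ co i j;
  case: (split_ordP i) => p ->; case: (split_ordP j) => q ->;
  rewrite /slK0 /slK1 ?block_mxEul ?block_mxEur ?block_mxEdl ?block_mxEdr.
- by rewrite mxE Normc.normc0.
- exact: coefPi co _ _.
- exact: coefQ co _ _.
- by rewrite mxE Normc.normc0.
- by rewrite mxE Normc.normc0.
- by rewrite mxE Normc.normc0.
- by rewrite mxE normcN; exact: coefW co _ _.
- by rewrite mxE Normc.normc0.
Qed.

Lemma slpair_system (l : C) (y p : R -> 'cV[C]_d) : slpair (fun t => l *: y t) y p ->
  ode a b (fun t => col_mx (y t) (p t))
          (fun t => (slK0 t + l *: slK1 t) *m col_mx (y t) (p t)).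
Proof.
move=> [h1 h2]; apply: ode_eq (ode_col h1 h2) _; apply: aeI_all => t _.
rewrite /slK0 /slK1 scale_block_mx !scaler0 add_block_mx mul_block_col !addr0 !mul0mx.
by rewrite add0r addr0 mulmxDl scalerN mulNmx -scalemxAl -scalemxAr.
Qed.

Lemma slpair_unique (l : C) (y p : R -> 'cV[C]_d) : slpair (fun t => l *: y t) y p ->
  y a = 0 -> p a = 0 -> forall t, t \in `[a, b] -> y t = 0 /\ p t = 0.
Proof.
move=> h ya pa t tI.
have [[k0 k00 H0] [k1 k10 H1]] := slK_bounded.
have k' : 0 <= k0 + normc l * k1 by rewrite addr_ge0 ?mulr_ge0 ?normc_ge0.
have [G G0 HG] := gronwall (d + d) ab' k'.
have z : col_mx (y t) (p t) = 0.
  apply/matrixP => i j; rewrite ord1 [RHS]mxE; apply: Normc.eq0_normc; apply/eqP.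
  rewrite eq_le normc_ge0 andbT.
  have := HG _ _ 0 0 (lexx _) (lexx _) (slpair_system h) _ _ t i tI.
  rewrite addr0 mulr0; apply.
    apply: aeI_mp H0 _; apply: aeI_imp H1 => s _ h1 h0 q; rewrite addr0.
    apply: normc_mulmx_le => i' j'.
    have -> (M N : 'M[C]_(d + d)) : (M + l *: N) i' j' =
      M i' j' + l * N i' j' by rewrite !mxE.
    apply: le_trans (normcD _ _) _; apply: lerD; first exact: h0.
    by rewrite Normc.normcM ler_wpM2l ?normc_ge0.
  by move=> q; rewrite ya pa col_mx0 mxE Normc.normc0.
by apply/eq_col_mx; rewrite col_mx0.
Qed.

End Lagrange.

(** * Lipschitz functions are square integrable *)

Section SquareIntegrable.
Context {R : realType} {d : nat}.
Local Notation C := (R[i]).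
Local Notation Re := (@complex.Re R).
Local Notation Im := (@complex.Im R).
Variables (a b : R) (P Q W : R -> 'M[R]_d).
Hypothesis ab : a <= b.
Hypothesis Om : in_Omega a b P Q W.

Lemma lip_measurable (f : R -> R) : lip a b f -> measurable_fun `[a, b]%classic f.
Proof.
move=> /lip_within_continuous cf.
by apply: subspace_continuous_measurable_fun => //; exact: measurable_itv.
Qed.

Lemma wformE (y : R -> 'cV[C]_d) t : wform W y t =
  \sum_i \sum_j W t i j * (Re (y t i 0) * Re (y t j 0) + Im (y t i 0) * Im (y t j 0)).
Proof.
rewrite /wform -mulmxA mxE cRe_sum; apply: eq_bigr => i _ /=.
rewrite adjmxE mxE mulr_sumr cRe_sum; apply: eq_bigr => j _ /=.
by rewrite !mxE !cReM !cImM cReJ cImJ /=; ring.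
Qed.

(** Functions built from the fundamental system must be shown to lie in [L2W]. The expansion
    [wformE] gives measurability; boundedness on an interval of finite length gives
    integrability. *)
Lemma lip_L2W (y : R -> 'cV[C]_d) : (forall i, lipC a b (fun t => y t i 0)) -> L2W a b W y.
Proof.
move=> yl; have ym : meas_cv a b y.
  by move=> i; have [h1 h2] := yl i; split; exact: lip_measurable.
split => //.
have [[_ [_ [Wm [kW HW]]]] _ _ _] := Om.
have wm : measurable_fun `[a, b]%classic (wform W y).
  rewrite (_ : wform W y = fun t => \sum_i \sum_j W t i j *
    (Re (y t i 0) * Re (y t j 0) + Im (y t i 0) * Im (y t j 0))); last first.
    by apply/funext => t; exact: wformE.
  apply: measurable_sum => i; apply: measurable_sum => j.
  apply: measurable_funM; first exact: Wm.
  have [h1 h2] := ym i; have [h3 h4] := ym j.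
  by apply: measurable_funD; exact: measurable_funM.
have /choice [M HM] : forall i, exists M : R, forall t, t \in `[a, b] ->
    `|Re (y t i 0)| <= M /\ `|Im (y t i 0)| <= M.
  move=> i; have [M M0 H] := lipC_bounded ab (yl i); exists M => t tI.
  by split; [apply: le_trans (Re_le_normc _) _|apply: le_trans (Im_le_normc _) _]; exact: H.
pose N : R := \sum_i \sum_j `|kW| * (M i * M j + M i * M j).
have wb : aeI a b (fun t => `|wform W y t| <= `|N|).
  apply: aeI_imp HW => t tI Wt; rewrite wformE; apply: le_trans (ler_norm N).
  apply: le_trans (ler_norm_sum _ _ _) _; apply: ler_sum => i _.
  apply: le_trans (ler_norm_sum _ _ _) _; apply: ler_sum => j _.
  have [r1 m1] := HM i t tI; have [r2 m2] := HM j t tI.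
  rewrite normrM; apply: ler_pM => //.
    by apply: le_trans (Wt i j) _; exact: ler_norm.
  apply: le_trans (ler_normD _ _) _; rewrite !normrM; apply: lerD; exact: ler_pM.
have wb' : aeI a b (fun t => (`|(EFin \o wform W y) t| <= `|N|%:E)%E).
  by apply: aeI_imp wb => t _ h /=; rewrite lee_fin.
have mE : measurable_fun `[a, b]%classic (EFin \o wform W y) by exact/measurable_EFinP.
have int : (@lebesgue_measure R).-integrable `[a, b]%classic (EFin \o wform W y).
  apply/integrableP; split => //.
  have mI : measurable (`[a, b]%classic : set R) by exact: measurable_itv.
  have le : (\int[@lebesgue_measure R]_(t in `[a, b]%classic) `|(EFin \o wform W y) t| <=
      \int[@lebesgue_measure R]_(t in `[a, b]%classic) `|N|%:E)%E.
    apply: ae_ge0_le_integral => //.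
    exact: (measurableT_comp (@abse_measurable R setT) mE).
  apply: le_lt_trans le _; rewrite integral_cst //.
  apply: lte_mul_pinfty => //.
  have h : (@lebesgue_measure R `[a, b]%classic < +oo)%E.
    by rewrite lebesgue_measure_itv /=; case: ifP => _; rewrite -?EFinD ltry.
  exact: h.
by apply: integrable_lty int; exact: measurable_itv.
Qed.

End SquareIntegrable.

(** * Smooth matrix functions and the determinant of a simple pencil *)

Lemma eq_deriv_fun (K : numFieldType) (f g f' g' : K -> K) :
  deriv_fun f f' -> f =1 g -> f' =1 g' -> deriv_fun g g'.
Proof. by move=> H /funext <- /funext <-. Qed.

Lemma deriv_fun_sum (K : numFieldType) n (F F' : 'I_n -> K -> K) :
  (forall i, deriv_fun (F i) (F' i)) ->
  deriv_fun (fun z => \sum_i F i z) (fun z => \sum_i F' i z).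
Proof.
elim: n F F' => [|n IH] F F' H.
  by apply: eq_deriv_fun (deriv_fun_cst 0) _ _ => z; rewrite big_ord0.
apply: eq_deriv_fun (deriv_funD (H ord0) (IH _ _ (fun i => H (lift ord0 i)))) _ _ => z;
  by rewrite big_ord_recl.
Qed.

Lemma deriv_funZ (K : numFieldType) c (f f' : K -> K) :
  deriv_fun f f' -> deriv_fun (fun z => c * f z) (fun z => c * f' z).
Proof.
move=> H; apply: eq_deriv_fun (deriv_funM (deriv_fun_cst c) H) _ _ => z //.
by rewrite mul0r add0r.
Qed.

Lemma deriv_fun_mulmx (K : numFieldType) m n p (A : 'M[K]_(m, n)) (X X' :
  K -> 'M[K]_(n, p)) i j :
  (forall i j, deriv_fun (fun z => X z i j) (fun z => X' z i j)) ->
  deriv_fun (fun z => (A *m X z) i j) (fun z => (A *m X' z) i j).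
Proof.
move=> H; apply: eq_deriv_fun (deriv_fun_sum (fun k => deriv_funZ (A i k) (H k j))) _ _ => z;
  by rewrite mxE.
Qed.

Lemma deriv_fun_mulmxr (K : numFieldType) m n p (X X' : K -> 'M[K]_(m, n)) (A :
  'M[K]_(n, p)) i j :
  (forall i j, deriv_fun (fun z => X z i j) (fun z => X' z i j)) ->
  deriv_fun (fun z => (X z *m A) i j) (fun z => (X' z *m A) i j).
Proof.
move=> H; apply: eq_deriv_fun (deriv_fun_sum (fun k => deriv_funZ (A k j) (H i k))) _ _ => z;
  by rewrite mxE; apply: eq_bigr => k _; rewrite mulrC.
Qed.

Lemma smooth_mulmx (K : numFieldType) m n p (A : 'M[K]_(m, n)) (X : K -> 'M[K]_(n, p)) i j :
  (forall i j, smooth (fun z => X z i j)) -> smooth (fun z => (A *m X z) i j).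
Proof.
move=> H; under eq_fun do rewrite mxE.
by apply: smooth_sum => k; apply: smoothM; [exact: smooth_cst|exact: H].
Qed.

Lemma smooth_mulmxr (K : numFieldType) m n p (X : K -> 'M[K]_(m, n)) (A : 'M[K]_(n, p)) i j :
  (forall i j, smooth (fun z => X z i j)) -> smooth (fun z => (X z *m A) i j).
Proof.
move=> H; under eq_fun do rewrite mxE.
by apply: smooth_sum => k; apply: smoothM; [exact: H|exact: smooth_cst].
Qed.

Lemma smooth_prod (K : numFieldType) n (F : 'I_n -> K -> K) :
  (forall i, smooth (F i)) -> smooth (fun z => \prod_i F i z).
Proof.
elim: n F => [|n IH] F H.
  by under eq_fun do rewrite big_ord0; exact: smooth_cst.
by under eq_fun do rewrite big_ord_recl; apply: smoothM => //; apply: IH.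
Qed.

Lemma smooth_det (K : numFieldType) n (M : K -> 'M[K]_n) :
  (forall i j, smooth (fun z => M z i j)) -> smooth (fun z => \det (M z)).
Proof.
move=> H; apply: smooth_sum => s; apply: smoothM; first exact: smooth_cst.
by apply: smooth_prod => i; exact: H.
Qed.

Lemma sum_leq_ord n r : (\sum_(j < n) (r <= j) = n - r)%N.
Proof.
elim: n => [|n IH]; first by rewrite big_ord0.
rewrite big_ord_recr /= IH; case: leqP => h; first by rewrite subSn // addn1.
by rewrite addn0; apply/eqP; rewrite (eqP (_ :
  n - r == 0)%N) ?subn_eq0 // ?(ltnW h) // eq_sym subn_eq0.
Qed.

Lemma col_inj_unit (F : fieldType) n (L : 'M[F]_n) :
  (forall x : 'cV_n, L *m x = 0 -> x = 0) -> L \in unitmx.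
Proof.
move=> H; rewrite -unitmx_tr -row_free_unit; apply: inj_row_free => v vL.
apply: trmx_inj; rewrite trmx0; apply: H.
by apply: trmx_inj; rewrite trmx_mul trmxK vL trmx0.
Qed.

(* Simplicity of the eigenvalue [z0] of the pencil [M], i.e. the absence of
   Jordan chains of length two, makes the order of vanishing of [\det M] equal
   to the defect of [M z0]. *)
Lemma leading_det_simple (K : numFieldType) n (M M' : K -> 'M[K]_n) z0 :
  (forall i j, smooth (fun z => M z i j)) ->
  (forall i j, deriv_fun (fun z => M z i j) (fun z => M' z i j)) ->
  (forall v w : 'cV_n, M z0 *m v = 0 -> M z0 *m w + M' z0 *m v = 0 -> v = 0) ->
  exists2 c, c != 0 & leading z0 (n - \rank (M z0)) (fun z => \det (M z)) c.
Proof.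
move=> SM dM simple; set r := \rank (M z0).
(* The columns of [V] from index [r] on span the kernel of [M z0]; the same columns of [M z *m V]
   vanish at [z0]. *)
pose V := invmx (row_ebase (M z0)).
have uV : V \in unitmx by rewrite unitmx_inv row_ebase_unit.
have N0 : M z0 *m V = col_ebase (M z0) *m pid_mx r.
  by rewrite -{1}[M z0]mulmx_ebase mulmxK // row_ebase_unit.
have N0col i (j : 'I_n) : (r <= j)%N -> (M z0 *m V) i j = 0.
  move=> rj; rewrite N0 mxE big1 // => k _; rewrite mxE.
  case: eqP => [kj|_]; last by rewrite mulr0.
  by rewrite kj ltnNge rj mulr0.
(* Leading coefficients by column: order one, hence the derivative, where the column vanishes at
   [z0], and order zero elsewhere. *)
pose L := \matrix_(i, j) (if (r <= j)%N then (M' z0 *m V) i j else (M z0 *m V) i j).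
have lead : leading z0 (n - r) (fun z => \det (M z *m V)) (\det L).
  rewrite -sum_leq_ord; apply: leading_det => i j; first exact: smooth_mulmxr.
  rewrite mxE; case: leqP => rj /=; last by [].
  split; first exact: N0col.
  exists (fun z => (M' z *m V) i j); first exact: deriv_fun_mulmxr.
  by rewrite mul1r.
have uL : L \in unitmx.
  apply: col_inj_unit => x Lx.
  (* The part of [x] on the vanishing columns. [L *m x = 0] makes [V *m x2] and [V *m x] a chain, so
     [simple] gives [x2 = 0]; on the remaining coordinates [pid_mx r] is injective. *)
  pose x2 := \col_j (if (r <= j)%N then x j 0 else 0).
  have Lx' : M z0 *m V *m x + M' z0 *m V *m x2 = 0.
    rewrite -Lx; apply/matrixP => i k;
      rewrite ord1 [LHS]mxE [RHS]mxE mxE [X in _ + X]mxE -big_split.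
    apply: eq_bigr => j _ /=; rewrite [x2 j 0]mxE [L i j]mxE.
    by case: leqP => rj; [rewrite N0col // mul0r add0r|rewrite mulr0 addr0].
  have Mx2 : M z0 *m V *m x2 = 0.
    apply/matrixP => i k; rewrite ord1 [LHS]mxE [RHS]mxE big1 // => j _; rewrite [x2 j 0]mxE.
    by case: leqP => rj; [rewrite N0col // mul0r|rewrite mulr0].
  have Vx2 : V *m x2 = 0.
    by apply: (simple _ (V *m x)); rewrite !mulmxA.
  have x20 : x2 = 0 by rewrite -[x2](mulKmx uV) Vx2 mulmx0.
  move: Lx'; rewrite x20 mulmx0 addr0 N0 -mulmxA => px.
  have {}px : pid_mx r *m x = 0 :> 'cV_n.
    by rewrite -[LHS](mulKmx (col_ebase_unit (M z0))) px mulmx0.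
  apply/matrixP => j k; rewrite ord1 [RHS]mxE; case: (leqP r j) => rj.
    by move/matrixP: x20 => /(_ j 0); rewrite !mxE rj.
  move/matrixP: px => /(_ j 0); rewrite [X in X = _]mxE [RHS]mxE (bigD1 j) //= big1.
    by rewrite mxE eqxx rj mul1r addr0.
  move=> i ij; rewrite mxE (_ : (j == i :> nat) = false) ?mul0r //.
  by apply/negbTE; rewrite eq_sym; exact: ij.
exists (\det L * (\det V)^-1).
  by rewrite mulf_neq0 ?invr_eq0 -?unitfE // -unitmxE.
have -> : (fun z => \det (M z)) = (fun z => \det (M z *m V) * (\det V)^-1).
  by apply/funext => z; rewrite det_mulmx mulfK // -unitfE -unitmxE.
rewrite -[(n - r)%N]addn0; apply: leadingM => //; last exact: smooth_cst.
by apply: smooth_det => i j; exact: smooth_mulmxr.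
Qed.

Lemma ode_usub (R : realType) (a b : R) m n (x g : R -> 'cV[R[i]]_(m + n)) :
  ode a b x g -> ode a b (fun t => usubmx (x t)) (fun t => usubmx (g t)).
Proof.
move=> [xl xd].
have E i : (fun t => usubmx (x t) i 0) = (fun t => x t (lshift n i) 0).
  by apply/funext => t; rewrite mxE.
split=> [i|]; first by rewrite E.
apply: aeI_imp xd => t _ xt i.
by rewrite -/(derC (fun s => usubmx (x s) i 0) t (usubmx (g t) i 0)) E mxE; exact: xt.
Qed.

Lemma ode_dsub (R : realType) (a b : R) m n (x g : R -> 'cV[R[i]]_(m + n)) :
  ode a b x g -> ode a b (fun t => dsubmx (x t)) (fun t => dsubmx (g t)).
Proof.
move=> [xl xd].
have E i : (fun t => dsubmx (x t) i 0) = (fun t => x t (rshift m i) 0).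
  by apply/funext => t; rewrite mxE.
split=> [i|]; first by rewrite E.
apply: aeI_imp xd => t _ xt i.
by rewrite -/(derC (fun s => dsubmx (x s) i 0) t (dsubmx (g t) i 0)) E mxE; exact: xt.
Qed.

(** * Eigenspaces, root subspaces and the kernel of the boundary matrix *)

Section Multiplicities.
Context {R : realType} {d : nat}.
Local Notation C := (R[i]).
Local Notation Re := (@complex.Re R).
Local Notation Im := (@complex.Im R).
Local Notation normc := (@Normc.normc R).
Local Notation cvec := ('cV[C]_d).
Variables (a b : R) (P Q W : R -> 'M[R]_d) (A B : 'M[C]_(d + d)).
Variables (phi pphi : C -> 'I_(d + d) -> R -> cvec).
Hypothesis ab : a < b.
Hypothesis Om : in_Omega a b P Q W.
Hypothesis bc : bc_ok A B.
Hypothesis fund : fund_sys a b P Q W phi pphi.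
Let ab' : a <= b := ltW ab.
Let aI : a \in `[a, b]. Proof. by rewrite in_itv /= lexx ab'. Qed.
Let bI : b \in `[a, b]. Proof. by rewrite in_itv /= lexx ab'. Qed.

Definition lincomb (f : 'I_(d + d) -> R -> cvec) (c : 'cV[C]_(d + d)) t : cvec :=
  \sum_j c j 0 *: f j t.

Definition bcmx (f p : C -> 'I_(d + d) -> R -> cvec) l : 'M[C]_(d + d) :=
  A *m PhiM a b f l + B *m PsiM a b p l.

Lemma fund_slpair l j :
  slpair a b P Q W (fun t => l *: phi l j t) (phi l j) (pphi l j).
Proof.
have [[yac pac dy dp] _] := fund l j.
have [M M0 HM] := ac_cv_bounded ab yac.
apply: (@ac_slpair _ _ _ _ _ _ _ ab Om _ _ _ (normc l * M)) => //.
- by rewrite mulr_ge0 ?normc_ge0.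
- apply: aeI_all => t tI i; rewrite mxE Normc.normcM.
  by rewrite ler_wpM2l ?normc_ge0 //; exact: HM.
- by apply: aeI_imp dp => t _ [dp' h1 h2]; exists dp' => //; rewrite h2 scalemxAr.
Qed.

Lemma lincomb_slpair (g y p : 'I_(d + d) -> R -> cvec) c :
  (forall j, slpair a b P Q W (g j) (y j) (p j)) ->
  slpair a b P Q W (lincomb g c) (lincomb y c) (lincomb p c).
Proof.
move=> H.
(* The index map allows induction on the number of terms while the index type stays fixed. *)
have gen n (F : 'I_n -> 'I_(d + d)) : slpair a b P Q W
    (fun t => \sum_k c (F k) 0 *: g (F k) t) (fun t => \sum_k c (F k) 0 *: y (F k) t)
    (fun t => \sum_k c (F k) 0 *: p (F k) t).
  elim: n F => [|n IH] F; last first.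
    apply: eq_slpair (slpairD (slpairZ ab (c (F ord0) 0) (H (F ord0)))
      (IH (fun k => F (lift ord0 k)))) _ _ _ => t; by rewrite big_ord_recl.
  have z0 : ode a b (fun=> 0 : cvec) (fun=> 0).
    split; first by move=> i; rewrite mxE; exact: lipC_cst.
    by apply: aeI_all => t _ i; rewrite mxE; exact: derC_cst.
  have z1 : slpair a b P Q W (fun=> 0) (fun=> 0) (fun=> 0).
    by split; apply: ode_eq z0 _; apply: aeI_all => t _; rewrite !mulmx0 ?subr0.
  by apply: eq_slpair z1 _ _ _ => t; rewrite big_ord0.
exact: gen _ id.
Qed.

Lemma lincombZ (y : 'I_(d + d) -> R -> cvec) l c t :
  lincomb (fun j t => l *: y j t) c t = l *: lincomb y c t.
Proof.
rewrite /lincomb scaler_sumr; apply: eq_bigr => j _.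
by rewrite !scalerA mulrC.
Qed.

(** Stated for arbitrary families, because it serves both the fundamental system and its derivative
    in [l]. *)
Lemma bcmx_lincomb (f p : C -> 'I_(d + d) -> R -> cvec) l c :
  row_mx A B *m Yab a b (lincomb (f l) c) (lincomb (p l) c) = bcmx f p l *m c.
Proof.
rewrite /Yab mul_row_col /bcmx mulmxDl -!mulmxA.
congr (_ + _); congr (_ *m _).
  apply/matrixP => i k; rewrite ord1 [RHS]mxE; case: (split_ordP i) => q ->.
    rewrite col_mxEu mxE summxE -sumrN; apply: eq_bigr => j _.
    by rewrite mxE [PhiM _ _ _ _ _ _]mxE col_mxEu mxE mulNr mulrC.
  rewrite col_mxEd summxE; apply: eq_bigr => j _.
  by rewrite mxE [PhiM _ _ _ _ _ _]mxE col_mxEd mulrC.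
apply/matrixP => i k; rewrite ord1 [RHS]mxE; case: (split_ordP i) => q ->.
  rewrite col_mxEu summxE; apply: eq_bigr => j _.
  by rewrite mxE [PsiM _ _ _ _ _ _]mxE col_mxEu mulrC.
rewrite col_mxEd summxE; apply: eq_bigr => j _.
by rewrite mxE [PsiM _ _ _ _ _ _]mxE col_mxEd mulrC.
Qed.

Local Notation M := (bcmx phi pphi).
Local Notation Y l c := (lincomb (phi l) c).
Local Notation Z l c := (lincomb (pphi l) c).

Lemma sol_slpair l c : slpair a b P Q W (fun t => l *: Y l c t) (Y l c) (Z l c).
Proof.
by apply: eq_slpair (lincomb_slpair c (fund_slpair l)) _ _ _ => // t; rewrite lincombZ.
Qed.

Lemma sol_init l c : col_mx (Y l c a) (Z l c a) = c.
Proof.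
apply/matrixP => i k; rewrite ord1.
have -> : c i 0 = \sum_j c j 0 * (col_mx (phi l j a) (pphi l j a)) i 0.
  rewrite (bigD1 i) //= big1 ?addr0; first by have [_ ->] := fund l i;
    rewrite !mxE eqxx mulr1.
  by move=> j ji; have [_ ->] := fund l j; rewrite !mxE eq_sym (negPf ji) mulr0.
case: (split_ordP i) => q ->.
  rewrite col_mxEu [LHS]summxE; apply: eq_bigr => j _.
  by rewrite col_mxEu mxE.
rewrite col_mxEd [LHS]summxE; apply: eq_bigr => j _.
by rewrite col_mxEd mxE.
Qed.

(** Both initial values of a solution vanishing almost everywhere are 0, and they form [c].
    Independence modulo null sets thus becomes independence of coefficient vectors. *)
Lemma sol_eq0 l c : aeI a b (fun t => Y l c t = 0) -> c = 0.
Proof.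
move=> Y0; have h := sol_slpair l c.
have ya : Y l c a = 0 by case: h => h _; exact: (ode_ae0 ab h Y0).
have za : Z l c a = 0 by exact: (slpair_p0 ab Om h Y0).
by rewrite -(sol_init l c) ya za col_mx0.
Qed.

Lemma sol_complete l (y p : R -> cvec) : slpair a b P Q W (fun t => l *: y t) y p ->
  forall t, t \in `[a, b] -> y t = Y l (col_mx (y a) (p a)) t /\
                          p t = Z l (col_mx (y a) (p a)) t.
Proof.
move=> h t tI; set c := col_mx _ _.
have h' : slpair a b P Q W (fun t => l *: (y t + (-1) *: Y l c t))
    (fun t => y t + (-1) *: Y l c t) (fun t => p t + (-1) *: Z l c t).
  apply: eq_slpair (slpairD h (slpairZ ab (-1) (sol_slpair l c))) _ _ _ => // s.
  by rewrite scalerDr !scalerA mulrC.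
have /eq_col_mx [ya pa] := sol_init l c.
have [||e1 e2] := slpair_unique ab Om h' _ _ tI; rewrite ?ya ?pa ?scaleN1r ?subrr //.
by split; apply/eqP; rewrite -subr_eq0 -scaleN1r; apply/eqP.
Qed.

(** Differentiating the equation in [l] adds the source [phi], so [psi] stands to [phi] as the
    second vector of a Jordan chain to the first, boundary condition aside. *)
Lemma fund_derive : exists psi ppsi : C -> 'I_(d + d) -> R -> cvec,
  (forall l j, slpair a b P Q W (fun t => l *: psi l j t + phi l j t) (psi l j) (ppsi l j)) /\
  (forall i j, smooth (fun l : C => M l i j) /\
               deriv_fun (fun l : C => M l i j) (fun l => bcmx psi ppsi l i j)).
Proof.
have [K0b K1b] := slK_bounded Om.
have sys j : param_sys a b (slK0 P Q) (slK1 W) (fun l t => col_mx (phi l j t) (pphi l j t)).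
  split => // [l|l l']; first exact: slpair_system (fund_slpair l j).
  by have [_ ->] := fund l j; have [_ ->] := fund l' j.
have /choice [y Hy] := fun j => param_derive ab' (sys j).
pose psi l j t : cvec := usubmx (y j l t); pose ppsi l j t : cvec := dsubmx (y j l t).
exists psi, ppsi.
have dphi t j i : t \in `[a, b] -> deriv_fun (fun l :
  C => phi l j t i 0) (fun l => psi l j t i 0).
  move=> tI; have [_ _ h] := Hy j; apply: eq_deriv_fun (h t (lshift d i) tI) _ _ => l.
    by rewrite col_mxEu.
  by rewrite mxE.
have dpphi t j i : t \in `[a, b] -> deriv_fun (fun l :
  C => pphi l j t i 0) (fun l => ppsi l j t i 0).
  move=> tI; have [_ _ h] := Hy j; apply: eq_deriv_fun (h t (rshift d i) tI) _ _ => l.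
    by rewrite col_mxEd.
  by rewrite mxE.
have sphi t j i : t \in `[a, b] -> smooth (fun l : C => phi l j t i 0).
  move=> tI; have := param_smooth ab' (lshift d i) (sys j) tI.
  by rewrite (_ : (fun l => _) = (fun l => phi l j t i 0)) //; apply/funext => l;
    rewrite col_mxEu.
have spphi t j i : t \in `[a, b] -> smooth (fun l : C => pphi l j t i 0).
  move=> tI; have := param_smooth ab' (rshift d i) (sys j) tI.
  by rewrite (_ : (fun l => _) = (fun l => pphi l j t i 0)) //; apply/funext => l;
    rewrite col_mxEd.
split.
  move=> l j; have [_ /(_ l) h _] := Hy j.
  have E t : (slK0 P Q t + l *: slK1 W t) *m y j l t +
      slK1 W t *m col_mx (phi l j t) (pphi l j t) =
      col_mx (invmx (cmx (P t)) *m ppsi l j t)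
        (cmx (Q t) *m psi l j t - cmx (W t) *m (l *: psi l j t + phi l j t)).
    rewrite -[y j l t]vsubmxK -/(psi l j t) -/(ppsi l j t) /slK0 /slK1.
    rewrite scale_block_mx !scaler0 add_block_mx !mul_block_col !addr0 !mul0mx !add0r.
    rewrite add_col_mx !addr0 mulmxDl scalerN !mulNmx mulmxDr -scalemxAl -scalemxAr.
    by rewrite opprD addrA.
  split; [apply: ode_eq (ode_usub h) _|apply: ode_eq (ode_dsub h) _]; apply: aeI_all => t _.
    by rewrite E col_mxKu.
  by rewrite E col_mxKd.
move=> i j; split.
  rewrite (_ : (fun l => _) = (fun l => (A *m PhiM a b phi l) i j + (B *m PsiM a b pphi
    l) i j)); last first.
    by apply/funext => l; rewrite mxE.
  apply: smoothD; apply: smooth_mulmx => k q.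
    rewrite (_ : (fun l => _) = (fun l => col_mx (- phi l q a) (phi l q b) k 0)); last first.
      by apply/funext => l; rewrite mxE.
    case: (split_ordP k) => p ->.
      rewrite (_ : (fun l => _) = (fun l => -1 * phi l q a p 0)); last first.
        by apply/funext => l; rewrite col_mxEu mxE mulN1r.
      by apply: smoothM; [exact: smooth_cst|exact: sphi].
    rewrite (_ : (fun l => _) = (fun l => phi l q b p 0)); first exact: sphi.
    by apply/funext => l; rewrite col_mxEd.
  rewrite (_ : (fun l => _) = (fun l => col_mx (pphi l q a) (pphi l q b) k 0)); last first.
    by apply/funext => l; rewrite mxE.
  case: (split_ordP k) => p ->.
    rewrite (_ : (fun l => _) = (fun l => pphi l q a p 0)); first exact: spphi.
    by apply/funext => l; rewrite col_mxEu.
  rewrite (_ : (fun l => _) = (fun l => pphi l q b p 0)); first exact: spphi.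
  by apply/funext => l; rewrite col_mxEd.
have dPhi k q : deriv_fun (fun l => PhiM a b phi l k q) (fun l => PhiM a b psi l k q).
  case: (split_ordP k) => p ->.
    by apply: eq_deriv_fun (deriv_funZ (-1) (dphi a q p aI)) _ _ => l;
      rewrite [RHS]mxE col_mxEu [RHS]mxE mulN1r.
  by apply: eq_deriv_fun (dphi b q p bI) _ _ => l; rewrite [RHS]mxE col_mxEd.
have dPsi k q : deriv_fun (fun l => PsiM a b pphi l k q) (fun l => PsiM a b ppsi l k q).
  case: (split_ordP k) => p ->.
    by apply: eq_deriv_fun (dpphi a q p aI) _ _ => l; rewrite [RHS]mxE col_mxEu.
  by apply: eq_deriv_fun (dpphi b q p bI) _ _ => l; rewrite [RHS]mxE col_mxEd.
by apply: eq_deriv_fun (deriv_funD (deriv_fun_mulmx A i j dPhi) (deriv_fun_mulmx B i j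
  dPsi)) _ _ => l;
  rewrite [RHS]mxE.
Qed.

Lemma bcmx_simple l (psi ppsi : C -> 'I_(d + d) -> R -> cvec) : Im l = 0 ->
  (forall l j, slpair a b P Q W (fun t => l *: psi l j t + phi l j t) (psi l j) (ppsi l j)) ->
  forall v w : 'cV[C]_(d + d), M l *m v = 0 -> M l *m w + bcmx psi ppsi l *m v = 0 -> v = 0.
Proof.
move=> Iml Hpsi v w Mv Mw; apply: (@sol_eq0 l).
have h1 := sol_slpair l v.
have h2 := slpairD (sol_slpair l w) (lincomb_slpair v (Hpsi l)).
apply: (no_jordan_chain ab Om bc Iml h1 _ (y := fun t => Y l w t + lincomb (psi l) v t)
   (py := fun t => Z l w t + lincomb (ppsi l) v t)).
- by rewrite bcmx_lincomb.
- apply: eq_slpair h2 _ _ _ => // t.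
  have -> : lincomb (fun j t => l *: psi l j t + phi l j t) v t =
      l *: lincomb (psi l) v t + Y l v t.
    by rewrite -lincombZ /lincomb -big_split; apply: eq_bigr => j _; rewrite /= scalerDr.
  by rewrite scalerDr addrA.
have -> : Yab a b (fun t => Y l w t + lincomb (psi l) v t) (fun t => Z l w t + lincomb
  (ppsi l) v t)
   = Yab a b (Y l w) (Z l w) + Yab a b (lincomb (psi l) v) (lincomb (ppsi l) v).
  by rewrite /Yab !add_col_mx opprD.
by rewrite mulmxDr !bcmx_lincomb.
Qed.

(** Passes from the operator to the first-order system. The source may use the continuous
    representative [y0] in place of [y], and its boundedness is what [ac_slpair] requires. *)
Lemma SLT_slpair l (y z u : R -> cvec) (F : R) : 0 <= F ->
  (forall t i, t \in `[a, b] -> normc (u t i 0) <= F) ->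
  SLT a b P Q W A B y z -> aeI a b (fun t => z t = l *: y t + u t) ->
  exists y0 p0, [/\ aeI a b (fun t => y0 t = y t),
    slpair a b P Q W (fun t => l *: y0 t + u t) y0 p0 &
    row_mx A B *m Yab a b y0 p0 = 0].
Proof.
move=> F0 uF [y0 [p0 [yy0 [yac pac] [dy dp] _ bc0]]] zE; exists y0, p0; split => //.
have [N N0 HN] := ac_cv_bounded ab yac.
have [kap [mu [k0 mu0 co]]] := in_Omega_coefs Om.
apply: (@ac_slpair _ _ _ _ _ _ _ ab Om _ _ _ (normc l * N + F)) => //.
- by rewrite addr_ge0 ?mulr_ge0 ?normc_ge0.
- apply: aeI_all => t tI i; rewrite !mxE; apply: le_trans (normcD _ _) _.
  rewrite Normc.normcM; apply: lerD; last exact: uF.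
  by rewrite ler_wpM2l ?normc_ge0 //; exact: HN.
apply: aeI_mp co _; apply: aeI_mp zE _; apply: aeI_mp yy0 _.
apply: aeI_imp dp => t _ [dp' h1 h2] yt zt co; exists dp' => //.
rewrite yt -zt h2 mulKVmx ?yt // cmx_unit.
exact: coercive_unit mu0 (coefWc co).
Qed.

Lemma SLT_eigenvector l (y z : R -> cvec) : SLT a b P Q W A B y z ->
  aeI a b (fun t => z t = l *: y t) ->
  exists2 c, M l *m c = 0 & aeI a b (fun t => y t = Y l c t).
Proof.
move=> yz zE.
have [||y0 [p0 [yy0 h bc0]]] := @SLT_slpair l y z (fun=> 0) 0 (lexx _) _ yz.
- by move=> t i _; rewrite mxE Normc.normc0.
- by apply: aeI_imp zE => t _ ->; rewrite addr0.
have {}h : slpair a b P Q W (fun t => l *: y0 t) y0 p0.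
  by apply: slpair_eq h; apply: aeI_all => t _; rewrite addr0.
have E := sol_complete h.
exists (col_mx (y0 a) (p0 a)); last first.
  by apply: aeI_imp yy0 => t tI <-; case: (E t tI).
rewrite -bcmx_lincomb -bc0 /Yab.
by have [<- <-] := E a aI; have [<- <-] := E b bI.
Qed.

Lemma eigenvalue_real l : is_eigenvalue a b P Q W A B l -> Im l = 0.
Proof.
move=> [y [yS yn0]]; have [|c Mc yE] := @SLT_eigenvector l y _ yS; first exact: aeI_all.
have [//|Y0] := eigenpair_real ab Om bc (sol_slpair l c) (etrans (bcmx_lincomb _ _ _ _) Mc).
by case: yn0; apply: aeI_mp Y0 _; apply: aeI_imp yE => t _ -> .
Qed.

(** By induction [z - l y], with [z] the image of [y], is already an eigenfunction or zero; together
    with [y] it forms a chain of length two, so it vanishes. *)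
Lemma gker_eigenvector l k y : Im l = 0 -> gker a b P Q W A B l k.+1 y ->
  exists2 c, M l *m c = 0 & aeI a b (fun t => y t = Y l c t).
Proof.
move=> Iml; elim: k y => [|k IH] y [z [yz zk]].
  apply: SLT_eigenvector yz _; case: zk => _; apply: aeI_imp => t _ /eqP.
  by rewrite subr_eq0 => /eqP.
have [c Mc zE] := IH _ zk.
have hc := sol_slpair l c.
have [N N0 HN] := ac_cv_bounded ab (ode_ac_cv (proj1 hc)).
have zE' : aeI a b (fun t => z t = l *: y t + Y l c t).
  by apply: aeI_imp zE => t _ <-; rewrite addrC subrK.
have [y0 [p0 [yy0 h bc0]]] := SLT_slpair N0 HN yz zE'.
have Y0 := no_jordan_chain ab Om bc Iml hc (etrans (bcmx_lincomb _ _ _ _) Mc) h bc0.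
apply: SLT_eigenvector yz _; apply: aeI_mp Y0 _; apply: aeI_imp zE' => t _ -> ->.
by rewrite addr0.
Qed.

Lemma sol_lip l c i : lipC a b (fun t => Y l c t i 0).
Proof. by case: (sol_slpair l c) => -[]. Qed.

Lemma sol_eigenspace l c : M l *m c = 0 -> sl_eigenspace a b P Q W A B l (Y l c).
Proof.
move=> Mc; exists (Y l c), (Z l c); have h := sol_slpair l c.
have [kap [mu [k0 mu0 co]]] := in_Omega_coefs Om.
have [h1 h2] := h; split.
- exact: aeI_all.
- by split; [exact: ode_ac_cv h1|exact: ode_ac_cv h2].
- split.
    case: h1 => _ h1; apply: aeI_mp co _; apply: aeI_imp h1 => t _ ht co.
    by eexists; [exact: ht|rewrite mulKVmx // cmx_unit (coefP co)].
  case: h2 => _ h2; apply: aeI_mp co _; apply: aeI_imp h2 => t _ ht co.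
  eexists; first exact: ht.
  rewrite opprB subrK mulKmx // cmx_unit; exact: coercive_unit mu0 (coefWc co).
- split; apply: (lip_L2W ab' Om) => i; first exact: sol_lip.
  by under eq_fun do rewrite mxE; apply: lipCM => //; [exact: lipC_cst|exact: sol_lip].
- by rewrite bcmx_lincomb.
Qed.

Lemma sol_gen_eigenspace l c : M l *m c = 0 ->
  sl_gen_eigenspace a b P Q W A B l (Y l c).
Proof.
move=> Mc; exists 1%N => //; exists (fun t => l *: Y l c t).
split; first exact: sol_eigenspace.
split; last by apply: aeI_all => t _; rewrite subrr.
apply: (lip_L2W ab' Om) => i.
by under eq_fun do rewrite subrr mxE; exact: lipC_cst.
Qed.

(** [S] is left abstract to cover the eigenspace and the root subspace at once: each consists,
    modulo null sets, of the solutions with coefficients in the kernel of [M l]. *)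
Lemma dim_ae_eigenspace l (S : (R -> cvec) -> Prop) :
  (forall c, M l *m c = 0 -> S (Y l c)) ->
  (forall y, S y -> exists2 c, M l *m c = 0 & aeI a b (fun t => y t = Y l c t)) ->
  dim_ae a b S (d + d - \rank (M l)).
Proof.
move=> S1 S2; rewrite -[\rank (M l)]mxrank_tr -mxrank_ker.
set K := kermx (M l)^T; split.
  have KE i : M l *m (row i (row_base K))^T = 0.
    apply: trmx_inj; rewrite trmx_mul trmxK trmx0.
    by apply/sub_kermxP; apply: submx_trans (row_sub _ _) _; rewrite eq_row_base.
  exists (fun i => Y l (row i (row_base K))^T); split.
    by move=> i; exact: S1.
  move=> c c0.
  pose r : 'rV[C]_(\rank K) := \row_i c i.
  have : (r *m row_base K)^T = 0.
    apply: (@sol_eq0 l); apply: aeI_imp c0 => t _ <-.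
    rewrite /lincomb; under [RHS]eq_bigr do rewrite scaler_sumr.
    rewrite exchange_big /=; apply: eq_bigr => j _.
    rewrite mxE mxE scaler_suml; apply: eq_bigr => i _.
    by rewrite scalerA !mxE.
  move/(congr1 trmx); rewrite trmxK trmx0 => /eqP.
  rewrite mulmx_free_eq0 ?row_base_free // => /eqP /matrixP r0 i.
  by have := r0 0 i; rewrite !mxE.
move=> m f Sf find.
have /choice [c Hc] := fun i => (let: ex_intro2 c h1 h2 := S2 _ (Sf i) in
   ex_intro (fun c => M l *m c = 0 /\ aeI a b (fun t => f i t = Y l c t)) c (conj h1 h2)).
pose Cm : 'M[C]_(m, d + d) := \matrix_i (c i)^T.
have CK : (Cm <= K)%MS.
  apply/row_subP => i; rewrite rowK; apply/sub_kermxP; rewrite -trmx_mul.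
  by have [-> _] := Hc i; rewrite trmx0.
have free : row_free Cm.
  apply: inj_row_free => v vC; apply/rowP => i; rewrite mxE.
  apply: (find (fun i => v 0 i)).
  have Hall : aeI a b (fun t => forall i, f i t = Y l (c i) t).
    by apply: aeI_fin => k; case: (Hc k).
  apply: aeI_imp Hall => t _ H.
  have -> : \sum_(k < m) v 0 k *: f k t = Y l (v *m Cm)^T t.
    under eq_bigr do rewrite H /lincomb scaler_sumr.
    rewrite exchange_big /=; apply: eq_bigr => j _.
    rewrite mxE mxE scaler_suml; apply: eq_bigr => k _.
    by rewrite scalerA !mxE.
  by rewrite vC trmx0 /lincomb big1 // => j _; rewrite mxE scale0r.
by rewrite -(eqP free); exact: mxrankS.
Qed.

End Multiplicities.

Theorem theorem5p1 (R : realType) (d : nat) (a b : R)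
    (P Q W : R -> 'M[R]_d) (A B : 'M[R[i]]_(d + d))
    (phi pphi : R[i] -> 'I_(d + d) -> R -> 'cV[R[i]]_d) :
  (2 <= d)%N -> a < b ->
  in_Omega a b P Q W -> bc_ok A B ->
  fund_sys a b P Q W phi pphi ->
  forall lam : R[i], is_eigenvalue a b P Q W A B lam ->
  exists n : nat,
    [/\ zero_order (SL_Gamma a b A B phi pphi) lam n,
        dim_ae a b (sl_gen_eigenspace a b P Q W A B lam) n &
        dim_ae a b (sl_eigenspace a b P Q W A B lam) n].
Proof.
move=> _ ab Om bc fund lam ev.
have Iml := eigenvalue_real ab Om bc fund ev.
(* The common value is the dimension of the kernel of the boundary matrix at [lam]. *)
exists (d + d - \rank (bcmx a b A B phi pphi lam))%N; split.
- have [psi [ppsi [Hpsi HM]]] := fund_derive A B ab Om fund.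
  have [c c0 H] := leading_det_simple (fun i j => (HM i j).1) (fun i j => (HM i j).2)
    (bcmx_simple ab Om bc fund Iml Hpsi).
  have [h1 h2] := leading_derive1n H.
  split; first exact: h1.
  by rewrite h2 mulf_neq0 // pnatr_eq0 -lt0n fact_gt0.
- apply: (dim_ae_eigenspace ab Om fund); first by move=> c; exact: sol_gen_eigenspace.
  move=> y [[//|k] _ yk]; exact: (gker_eigenvector ab Om bc fund Iml yk).
- apply: (dim_ae_eigenspace ab Om fund); first by move=> c; exact: sol_eigenspace.
  by move=> y yS; apply: (SLT_eigenvector ab Om fund yS); exact: aeI_all.
Qed.
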